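(* Assume that $D$ is a bounded strictly convex domain in a complex Banach space. If $S=\{f_t:D\to D\}_{t\ge0}$ is a one-parameter continuous semigroup of nonexpansive mappings with respect to the Kobayashi distance $k_D$, and there exists $t_0>0$ such that $\mathrm{Fix}(f_{t_0})=\emptyset$ and the mapping $f_{t_0}$ is compact, then there exists $\xi\in\partial D$ such that the semigroup $S$ converges uniformly on bounded sets of $D$ to $\xi$, i.e. $\sup_{x\in C}\|f_t(x)-\xi\|\to0$ as $t\to\infty$ for every $k_D$-bounded set $C\subset D$.
   Context: $\overline{D}$ is the closure of $D$ in the norm topology and $\partial D=\overline{D}\setminus D$. $D$ is strictly convex if for any distinct $z,w\in\overline{D}$ the open segment $\{sz+(1-s)w:s\in(0,1)\}$ lies in $D$. Kobayashi distance on a bounded convex domain $D$ of a complex Banach space: for $z,w\in D$, $$k_D(z,w)=\inf\{k_\Delta(0,\gamma):\exists\,\varphi\in\mathrm{Hol}(\Delta,D),\ \varphi(0)=z,\ \varphi(\gamma)=w\},$$ where $\Delta\subset\mathbb{C}$ is the open unit disc, $\mathrm{Hol}(\Delta,D)$ is the set of holomorphic maps $\Delta\to D$, and $k_\Delta$ is the Poincaré metric on $\Delta$, so that $k_\Delta(0,\gamma)=\operatorname{artanh}|\gamma|$. A map $f:D\to D$ is nonexpansive with respect to $k_D$ if $k_D(f(x),f(y))\le k_D(x,y)$ for all $x,y\in D$; it is compact if the norm closure of $f(D)$ is compact in $\overline{D}$. $\mathrm{Fix}(f)=\{x\in D:f(x)=x\}$. A family $S=\{f_t:D\to D\}_{t\ge0}$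 is a one-parameter continuous semigroup if $f_{s+t}=f_t\circ f_s$ for all $s,t\ge0$ and $\lim_{t\to0^+}f_t(y)=f_0(y)=y$ for every $y\in D$ (the topology of $k_D$ on $D$ coincides with the norm topology). *)

(* Defs.v *)
From HB Require Import structures.
From mathcomp Require Import all_boot all_order all_algebra.
From mathcomp Require Import all_classical all_reals all_analysis.
From mathcomp.real_closed Require Export complex.

Set Implicit Arguments.
Unset Strict Implicit.
Unset Printing Implicit Defensive.

Export numFieldNormedType.Exports.
Import Order.TTheory GRing.Theory Num.Theory.
Local Open Scope classical_set_scope.
Local Open Scope ring_scope.

(* The norm of a normed module over [R[i]] takes its values in [R[i]], where
   [0 <= z] forces [z] to be real; [rnorm] is that same norm as an element of
   [R]. *)
Definition rnorm (R : realType) (V : normedModType R[i]) (x : V) : R :=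
  complex.Re `|x|.

Definition boundary (T : topologicalType) (D : set T) : set T :=
  closure D `\` D.

Definition domain (T : topologicalType) (D : set T) : Prop :=
  [/\ D !=set0, open D & connected D].

Definition strictly_convex (R : realType) (V : normedModType R[i])
    (D : set V) : Prop :=
  forall z w : V, closure D z -> closure D w -> z <> w ->
  forall s : R, 0 < s < 1 -> D (s%:C%C *: z + (1 - s)%:C%C *: w).

Definition unit_disc (R : realType) : set R[i]^o :=
  [set z : R[i]^o | rnorm z < 1].

(* Scalars of [V] being complex, [derivable phi z 1] is the existence of the
   complex derivative of [phi] at [z]. A member of Hol(Delta, D) is represented
   by a total function, whose values outside the disc are irrelevant. *)
Definition holomorphic_disc (R : realType) (V : normedModType R[i])
    (D : set V) (phi : R[i]^o -> V) : Prop :=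
  set_fun (@unit_disc R) D phi /\
  (forall z, unit_disc z -> derivable phi z 1).

Definition artanh (R : realType) (x : R) : R := ln ((1 + x) / (1 - x)) / 2.

Definition poincare_dist (R : realType) (z w : R[i]^o) : R :=
  artanh (rnorm ((z - w) / (1 - z * (w : R[i])^*%C) : R[i]^o)).

Lemma poincare_dist0 (R : realType) (g : R[i]^o) :
  poincare_dist 0 g = artanh (rnorm g).
Proof.
by rewrite /poincare_dist mul0r subr0 divr1 sub0r /rnorm normrN.
Qed.

(* The infimum is taken in the extended reals, so that it is not an arbitrary
   value when no disc joins [z] to [w]; this never happens for [z], [w] in a
   convex domain [D], where the distance is finite. *)
Definition kobayashi_dist (R : realType) (V : normedModType R[i])
    (D : set V) (z w : V) : \bar R :=
  ereal_inf [set (poincare_dist 0 g)%:E | g in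
    [set g : R[i]^o | unit_disc g /\
      exists phi : R[i]^o -> V,
        [/\ holomorphic_disc D phi, phi 0 = z & phi g = w]]].

Definition kobayashi_bounded (R : realType) (V : normedModType R[i])
    (D C : set V) : Prop :=
  exists M : R, forall x y, C x -> C y -> (kobayashi_dist D x y <= M%:E)%E.

(* Self-maps of [D] are represented by total functions [V -> V], and
   one-parameter families indexed by [0, +oo[ by total functions [R -> V -> V];
   values outside [D] and at negative parameters are never constrained. *)
Definition nonexpansive (R : realType) (V : normedModType R[i])
    (D : set V) (f : V -> V) : Prop :=
  forall x y, D x -> D y ->
  (kobayashi_dist D (f x) (f y) <= kobayashi_dist D x y)%E.

Definition compact_map (T : topologicalType) (D : set T) (f : T -> T) : Prop :=
  compact (closure (f @` D)).

Definition Fix (T : Type) (D : set T) (f : T -> T) : set T :=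
  [set x | D x /\ f x = x].

Definition continuous_semigroup (R : realType) (V : normedModType R[i])
    (D : set V) (f : R -> V -> V) : Prop :=
  [/\ forall t, 0 <= t -> set_fun D D (f t),
      forall s t x, 0 <= s -> 0 <= t -> D x -> f (s + t) x = f t (f s x),
      forall y, D y -> f 0 y = y &
      forall y, D y -> f t y @[t --> 0^'+] --> y].

(* [sup] is the real supremum, which is 0 on the empty set and is meaningful
   only on sets that are bounded above; the latter holds as soon as the
   [f t @` C], for [t] large, are subsets of one bounded set. *)
Definition cvg_uniformly_on (R : realType) (V : normedModType R[i])
    (C : set V) (f : R -> V -> V) (xi : V) : Prop :=
  sup [set rnorm (f t x - xi) | x in C] @[t --> +oo] --> (0 : R).

(* Main.v *)
Require Import Defs.
From mathcomp Require Import all_boot all_order all_algebra.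
From mathcomp Require Import all_classical all_reals all_analysis.
From mathcomp Require Import ring lra.
Import Order.TTheory GRing.Theory Num.Theory.
Local Open Scope classical_set_scope.
Local Open Scope ring_scope.
Local Open Scope complex_scope.
Set Implicit Arguments.
Unset Strict Implicit.
Unset Printing Implicit Defensive.

(** Complex analysis is reduced to a mean value property: a function on the disc
    that is continuous at [z0] and complex differentiable elsewhere is at [z0] the
    limit of its averages over equidistributed points of a small circle. This is
    Goursat's theorem for [h (z0 + exp w)], in the form of dyadic Riemann sums. It
    gives the maximum principle for convex functions of vector-valued maps, hence
    Schwarz's lemma and a Harnack inequality on convex domains.

    In place of the Kobayashi distance one may use an integer-valued one: the least
    length of a chain in [D] whose consecutive points are at Kobayashi distance
    less than a fixed constant. Chains are preserved by nonexpansive maps, combine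
    under convex combinations, can be cut, and by Harnack's inequality cannot
    approach the boundary quickly.

    Let [T = f t0]. If some orbit of [T] does not leave all bounded sets, it is
    bounded (Calka); then the fixed points of the contractions [s T + (1 - s) x]
    stay in a bounded set and cluster, as [s] tends to 1, at a fixed point of [T].
    So the orbits of [T] leave every bounded set. Karlsson's argument with the times
    of record distance shows that they converge to a single boundary point [xi]; strict
    convexity enters because the midpoint of two distinct boundary points lies in
    [D]. The same midpoint argument shows that points at bounded distance from
    points tending to [xi] tend to [xi], if they stay in a compact set; this gives
    uniformity and passes from [T] to the semigroup. *)

(** * Real-valued norms *)

Section Rnorm.
Variables (R : realType) (V : normedModType R[i]).
Implicit Types (x y z : V) (a : R[i]).

Lemma normE x : `|x| = (rnorm x)%:C.
Proof. by rewrite /rnorm RRe_real // ger0_real. Qed.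

Lemma rnorm_ge0 x : 0 <= rnorm x.
Proof. by rewrite -ler0c -normE. Qed.

Lemma rnorm0 : rnorm (0 : V) = 0.
Proof. by rewrite /rnorm normr0. Qed.

Lemma rnorm_eq0 x : rnorm x = 0 -> x = 0.
Proof. by move=> h; apply/normr0_eq0; rewrite normE h. Qed.

Lemma rnorm_gt0 x : x != 0 -> 0 < rnorm x.
Proof.
by move=> x0; rewrite lt_neqAle rnorm_ge0 andbT eq_sym; apply: contra x0 => /eqP/rnorm_eq0 ->.
Qed.

Lemma rnormN x : rnorm (- x) = rnorm x.
Proof. by rewrite /rnorm normrN. Qed.

Lemma rnormB x y : rnorm (x - y) = rnorm (y - x).
Proof. by rewrite -rnormN opprB. Qed.

Lemma rnormD x y : rnorm (x + y) <= rnorm x + rnorm y.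
Proof. by rewrite -lecR rmorphD /= -!normE ler_normD. Qed.

Lemma rnorm_tri x y z : rnorm (x - z) <= rnorm (x - y) + rnorm (y - z).
Proof. by have := rnormD (x - y) (y - z); rewrite addrA subrK. Qed.
End Rnorm.

Section Cnorm.
Variable R : realType.
Implicit Types (z w : R[i]^o).

Lemma rnormZ (V : normedModType R[i]) (a : R[i]^o) (x : V) :
  rnorm (a *: x) = rnorm a * rnorm x.
Proof. by apply: (@complexI R); rewrite -normE normrZ rmorphM /= -!normE. Qed.

Lemma rnormM z w : rnorm (z * w : R[i]^o) = rnorm z * rnorm w.
Proof. exact: rnormZ. Qed.

Lemma rnormC (r : R) : rnorm (r%:C : R[i]^o) = `|r|.
Proof. by rewrite /rnorm normc_def /= expr0n addr0 sqrtr_sqr. Qed.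

Lemma rnormC_ge0 (r : R) : 0 <= r -> rnorm (r%:C : R[i]^o) = r.
Proof. by move=> h; rewrite rnormC ger0_norm. Qed.

Lemma rnorm1 : rnorm (1 : R[i]^o) = 1.
Proof. exact: (rnormC_ge0 ler01). Qed.

Lemma rnormV z : rnorm (z^-1 : R[i]^o) = (rnorm z)^-1.
Proof.
have [->|z0] := eqVneq z 0; first by rewrite invr0 rnorm0 invr0.
have h : rnorm (z^-1 : R[i]^o) * rnorm z = 1 by rewrite -rnormM mulVf // rnorm1.
have h0 : rnorm z != 0 by apply: contra z0 => /eqP/rnorm_eq0 ->.
by rewrite -[LHS]mulr1 -(divff h0) mulrA h mul1r.
Qed.

Lemma rnorm_sqr z : rnorm z ^+ 2 = complex.Re z ^+ 2 + complex.Im z ^+ 2.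
Proof. by rewrite /rnorm normc_def /= sqr_sqrtr // addr_ge0 ?sqr_ge0. Qed.

Lemma rnorm_Re z : `|complex.Re z| <= rnorm z.
Proof.
by rewrite -(@ler_pXn2r _ 2) ?nnegrE ?rnorm_ge0 // rnorm_sqr real_normK ?num_real // lerDl sqr_ge0.
Qed.

Lemma rnorm_Im z : `|complex.Im z| <= rnorm z.
Proof.
by rewrite -(@ler_pXn2r _ 2) ?nnegrE ?rnorm_ge0 // rnorm_sqr real_normK ?num_real // lerDr sqr_ge0.
Qed.

Lemma rnorm_ReIm z : rnorm z <= `|complex.Re z| + `|complex.Im z|.
Proof.
rewrite -(@ler_pXn2r _ 2) ?nnegrE ?rnorm_ge0 ?addr_ge0 // rnorm_sqr sqrrD !real_normK ?num_real //.
by rewrite -addrA lerD2l lerDr mulrn_wge0 // mulr_ge0.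
Qed.
End Cnorm.

(** * Topology through the real-valued norm *)

Section NbhsRnorm.
Variables (R : realType) (V : normedModType R[i]).

Lemma nbhs_rnormP (x : V) (A : set V) :
  nbhs x A <-> exists2 e : R, 0 < e & forall y, rnorm (y - x) < e -> A y.
Proof.
rewrite -nbhs_nbhs_norm; split=> [[e e0 h]|[e e0 h]].
  move: e0; rewrite /= ltcE /= => /andP[/eqP ei er].
  exists (complex.Re e) => // y hy; apply: h; rewrite /ball_/= distrC normE.
  by rewrite ltcE /= ei eqxx hy.
exists e%:C; first by rewrite /= ltcR.
by move=> y; rewrite /ball_/= distrC normE ltcR; exact: h.
Qed.

Lemma closure_rnormP (A : set V) (x : V) :
  closure A x <-> forall e : R, 0 < e -> exists2 y, A y & rnorm (y - x) < e.
Proof.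
split=> [h e e0|h B /nbhs_rnormP[e e0 hB]].
  have [|y [Ay yB]] := h [set y | rnorm (y - x) < e]; last by exists y.
  by apply/nbhs_rnormP; exists e.
by have [y Ay hy] := h e e0; exists y; split=> //; apply: hB.
Qed.

Lemma compact_cluster (K : set V) (u : nat -> V) :
  compact K -> (forall n, K (u n)) ->
  exists2 q, K q & forall (e : R) N, 0 < e -> exists2 n, (N <= n)%N & rnorm (u n - q) < e.
Proof.
move=> cK hu.
have [|q] := cK (u @ \oo) _; first by exists 0%N => // n _; exact: hu.
move=> [Kq cl]; exists q => // e N e0.
have [||y [[m hNm hm] hy]] := cl (u @` [set n | (N <= n)%N]) [set y | rnorm (y - q) < e].
- by exists N => // n /= hn; exists n.
- by apply/nbhs_rnormP; exists e.
by exists m => //; rewrite hm.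
Qed.

End NbhsRnorm.

(** * Complex differentiability *)

Section Cdiff.
Variables (R : realType) (V : normedModType R[i]).
Implicit Types (F G : R[i]^o -> V) (z w : R[i]^o).

Definition cdiff_at F z (L : V) : Prop := forall e : R, 0 < e ->
  exists2 d : R, 0 < d & forall w, rnorm (w - z) < d ->
    rnorm (F w - F z - (w - z) *: L) <= e * rnorm (w - z).

Lemma derivable_cdiffP F z : derivable F z 1 <-> exists L, cdiff_at F z L.
Proof.
split=> [/cvg_ex[L dF]|[L hL]].
  exists L => e e0.
  have /dF/nbhs_rnormP[d d0 hd] : nbhs L [set y | rnorm (y - L) < e].
    by apply/nbhs_rnormP; exists e.
  exists d => // w wz; have [->|wz0] := eqVneq w z.
    by rewrite !subrr scale0r subr0 !rnorm0 mulr0.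
  have := hd (w - z).
  rewrite subr0 => /(_ wz); rewrite subr_eq0 => /(_ wz0).
  rewrite /= /shift/= scaler1 subrK => h.
  have -> : F w - F z - (w - z) *: L = (w - z) *: ((w - z)^-1 *: (F w - F z) - L).
    by rewrite [RHS]scalerBr scalerA mulfV ?subr_eq0 // scale1r.
  by rewrite rnormZ mulrC ler_wpM2r ?rnorm_ge0 // ltW.
apply/cvg_ex; exists L => A /nbhs_rnormP[e e0 hA].
have [d d0 hd] := hL (e / 2) (divr_gt0 e0 (ltr0Sn _ 1)).
apply/nbhs_rnormP; exists d => // h; rewrite subr0 => hd' h0; apply: hA.
rewrite /= scaler1; have := hd (h + z); rewrite addrK => /(_ hd') le.
have hp : 0 < rnorm (h : R[i]^o) by rewrite rnorm_gt0.
have -> : h^-1 *: (F (h + z) - F z) - L = h^-1 *: (F (h + z) - F z - h *: L).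
  by rewrite [RHS]scalerBr scalerA mulVf // scale1r.
rewrite rnormZ rnormV mulrC ltr_pdivrMr //; apply: le_lt_trans le _.
by rewrite ltr_pM2r // ltr_pdivrMr // ltr_pMr // ltr1n.
Qed.

Lemma continuous_rnormP F z : {for z, continuous F} <-> forall e : R, 0 < e ->
  exists2 d : R, 0 < d & forall w, rnorm (w - z) < d -> rnorm (F w - F z) < e.
Proof.
split=> [cF e e0|h A /nbhs_rnormP[e e0 hA]].
  have /cF/nbhs_rnormP[d d0 hd] : nbhs (F z) [set y | rnorm (y - F z) < e].
    by apply/nbhs_rnormP; exists e.
  by exists d.
by have [d d0 hd] := h e e0; apply/nbhs_rnormP; exists d => // w /hd /hA.
Qed.

(** Caratheodory's form of the derivative: the product and chain rules reduce to the continuity of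
    slope functions. *)
Lemma derivable_slopeP F z : derivable F z 1 <->
  exists Q : R[i]^o -> V, {for z, continuous Q} /\ forall w, F w = F z + (w - z) *: Q w.
Proof.
rewrite derivable_cdiffP; split=> [[L hL]|[Q [cQ hQ]]].
  pose Q w := if w == z then L else (w - z)^-1 *: (F w - F z).
  have hQ w : F w = F z + (w - z) *: Q w.
    rewrite /Q; have [->|wz] := eqVneq w z; first by rewrite subrr scale0r addr0.
    by rewrite scalerA mulfV ?subr_eq0 // scale1r addrC subrK.
  exists Q; split=> //; apply/continuous_rnormP => e e0.
  have [d d0 hd] := hL (e / 2) (divr_gt0 e0 (ltr0Sn _ 1)); exists d => // w wz.
  have [->|wz0] := eqVneq w z; first by rewrite subrr rnorm0.
  have Qz : Q z = L by rewrite /Q eqxx.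
  have := hd w wz; rewrite hQ [F z + _]addrC addrK -Qz -scalerBr rnormZ mulrC.
  rewrite ler_pM2r; last by rewrite rnorm_gt0 // subr_eq0.
  move=> /le_lt_trans; apply.
  by rewrite ltr_pdivrMr // ltr_pMr // ltr1n.
exists (Q z) => e e0; have /continuous_rnormP/(_ _ e0)[d d0 hd] := cQ.
exists d => // w /hd wz; rewrite hQ [F z + _]addrC addrK -scalerBr rnormZ mulrC.
by rewrite ler_wpM2r ?rnorm_ge0 // ltW.
Qed.

Lemma derivable_cont F z : derivable F z 1 -> {for z, continuous F}.
Proof.
by move=> dF; apply: differentiable_continuous; apply/derivable1_diffP.
Qed.

End Cdiff.

Section CdiffOps.
Variables (R : realType) (V : normedModType R[i]).
Implicit Types (F G : R[i]^o -> V) (a g : R[i]^o -> R[i]^o) (z w : R[i]^o).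

Lemma derivable_scale a F z :
  derivable a z 1 -> derivable F z 1 -> derivable (fun w => a w *: F w) z 1.
Proof.
move=> da dF; have ca := derivable_cont da.
move: da dF => /derivable_slopeP[q [cq hq]] /derivable_slopeP[Q [cQ hQ]].
apply/derivable_slopeP; exists (fun w => a w *: Q w + q w *: F z); split.
  have c1 : {for z, continuous (fun w => a w *: Q w)}.
    exact: (@cvgZ R[i] V R[i]^o (nbhs z) _ a Q _ _ ca cQ).
  have c2 : {for z, continuous (fun w => q w *: F z)}.
    exact: (@cvgZr_tmp R[i] V R[i]^o (nbhs z) _ q _ _ cq).
  exact: (@cvgD R[i] V R[i]^o (nbhs z) _ _ _ _ _ c1 c2).
move=> w; rewrite hQ scalerDr [X in X *: F z]hq scalerDl -addrA; congr (_ + _).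
by rewrite scalerDr !scalerA [a w * _]mulrC addrC.
Qed.

Lemma derivable_comp F g z :
  derivable g z 1 -> derivable F (g z) 1 -> derivable (F \o g) z 1.
Proof.
move=> dg dF; have cg := derivable_cont dg.
move: dg dF => /derivable_slopeP[q [cq hq]] /derivable_slopeP[Q [cQ hQ]].
apply/derivable_slopeP; exists (fun w => q w *: Q (g w)); split.
  exact: (@cvgZ R[i] V R[i]^o (nbhs z) _ q (Q \o g) _ _ cq (continuous_comp cg cQ)).
move=> w /=; rewrite scalerA hQ; congr (_ + _ *: _).
by rewrite [X in X - _]hq addrC addKr.
Qed.

Lemma derivable_lin (u z0 z : R[i]^o) : derivable (fun w : R[i]^o => z0 + u * w : R[i]^o) z 1.
Proof.
apply/derivable_slopeP; exists (fun=> u); split.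
  by apply/continuous_rnormP => e e0; exists 1 => // w _; rewrite subrr rnorm0.
by move=> w; rewrite [_ *: u]mulrC -addrA -mulrDr subrKC.
Qed.

End CdiffOps.

Lemma derivable_scalel (R : realType) (V : normedModType R[i]) (k : R[i]^o)
    (F : R[i]^o -> V) (z : R[i]^o) :
  derivable F z 1 -> derivable (fun w => k *: F w) z 1.
Proof.
move=> dF; have dk : derivable (fun=> k : R[i]^o) z 1.
  exact: derivable_cst.
exact: (derivable_scale dk dF).
Qed.

Lemma derivable_scaler (R : realType) (V : normedModType R[i]) (a : R[i]^o -> R[i]^o)
    (v : V) (z : R[i]^o) :
  derivable a z 1 -> derivable (fun w => a w *: v) z 1.
Proof.
by move=> da; apply: (@derivable_scale R V a (fun=> v) z da); exact: derivable_cst.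
Qed.

(** * The complex exponential *)

Section RealSlope.
Variable R : realType.

Lemma is_derive_slope (f : R -> R) (l : R) : is_derive (0 : R) 1 f l ->
  forall e : R, 0 < e -> exists2 d : R, 0 < d &
    forall x, `|x| < d -> `|f x - f 0 - x * l| <= e * `|x|.
Proof.
move=> [df dl] e e0.
have [/= d d0 hd] : \forall h \near (0 : R)^', `|h^-1 *: (f (h *: 1 + 0) - f 0) - l| < e.
  have := df; rewrite /derivable => /cvgr_dist_lt/(_ _ e0).
  move: dl; rewrite /derive => ->.
  by apply: filterS => h; rewrite distrC.
exists d => // x xd; have [->|x0] := eqVneq x 0.
  by rewrite subrr mul0r subr0 normr0 mulr0.
have := hd x; rewrite /= sub0r normrN => /(_ xd x0).
rewrite addr0 /GRing.scale/= mulr1 => /ltW le.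
have -> : f x - f 0 - x * l = x * (x^-1 * (f x - f 0) - l).
  by rewrite mulrBr mulrA divff // mul1r.
by rewrite normrM mulrC ler_wpM2r.
Qed.
End RealSlope.

Section Cexp.
Variable R : realType.
Implicit Types z w : R[i]^o.

Definition cexp (z : R[i]^o) : R[i]^o :=
  (expR (complex.Re z) * cos (complex.Im z)) +i* (expR (complex.Re z) * sin (complex.Im z)).

Lemma cexpD z w : cexp (z + w) = cexp z * cexp w.
Proof.
case: z w => [a b] [c d]; apply/eqP; rewrite eq_complex /= expRD sinD cosD.
by apply/andP; split; apply/eqP; ring.
Qed.

Lemma rnorm_cexp z : rnorm (cexp z) = expR (complex.Re z).
Proof.
apply/eqP; rewrite -(@eqrXn2 _ 2) ?rnorm_ge0 ?expR_ge0 // rnorm_sqr /=.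
by rewrite !exprMn -mulrDr cos2Dsin2 mulr1.
Qed.

Lemma cexp_pi z : cexp (z + 0 +i* pi) = - cexp z.
Proof.
case: z => a b; apply/eqP; rewrite eq_complex /= addr0 cosDpi sinDpi !mulrN.
by rewrite !eqxx.
Qed.

Lemma cexp_slope0 (e : R) : 0 < e -> exists2 d : R, 0 < d &
  forall z, rnorm z < d -> rnorm (cexp z - 1 - z) <= e * rnorm z.
Proof.
move=> e0.
(* The real and the imaginary part each contribute an error of at most three times [e' * r], hence
   the 6. The bounds [e' <= 1] and [r < e' / 2] keep [expR x] at most 2. *)
have e6 : 0 < Num.min (e / 6) 1 by rewrite lt_min ltr01 andbT; lra.
set e' := Num.min (e / 6) 1 in e6.
have e'1 : e' <= 1 by rewrite ge_min lexx orbT.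
have e'6 : e' <= e / 6 by rewrite ge_min lexx.
have [d1 d10 h1] := is_derive_slope (is_derive_expR 0) e6.
have [d2 d20 h2] := is_derive_slope (is_derive_cos 0) e6.
have [d3 d30 h3] := is_derive_slope (is_derive_sin 0) e6.
exists (Num.min (Num.min d1 d2) (Num.min d3 (e' / 2))).
  by rewrite !lt_min d10 d20 d30 divr_gt0.
move=> z; rewrite !lt_min => /andP[/andP[z1 z2] /andP[z3 z4]].
have xz := rnorm_Re z; have yz := rnorm_Im z.
have := h1 _ (le_lt_trans xz z1); have := h2 _ (le_lt_trans yz z2).
have := h3 _ (le_lt_trans yz z3).
move: xz yz; set r := rnorm z; case: z @r z1 z2 z3 z4 => x y r z1 z2 z3 z4 /=.
rewrite expR0 cos0 sin0 oppr0 !mulr0 !subr0 !mulr1 !addr0 => xr yr hs hc hx.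
apply: le_trans (rnorm_ReIm _) _ => /=; rewrite !subr0.
have r0 : 0 <= r := rnorm_ge0 _.
have ex1 : `|expR x - 1| <= 2 * r.
  have -> : expR x - 1 = (expR x - 1 - x) + x by ring.
  apply: le_trans (ler_normD _ _) _.
  have : e' * `|x| <= r by rewrite -[r]mul1r ler_pM // ltW.
  by move: hx xr; lra.
have ex2 : expR x <= 2.
  have : expR x - 1 <= 2 * r by apply: le_trans (ler_norm _) ex1.
  by move: z4 e'1; rewrite -/r; lra.
have hx' : `|expR x - 1 - x| <= e' * r by apply: le_trans hx _; rewrite ler_wpM2l // ltW.
have hc' : `|cos y - 1| <= e' * r by apply: le_trans hc _; rewrite ler_wpM2l // ltW.
have hs' : `|sin y - y| <= e' * r.
  by move: hs; rewrite ?addr0 ?subr0 => hs; apply: le_trans hs _; rewrite ler_wpM2l // ltW.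
have t1 : `|expR x * (cos y - 1)| <= 2 * (e' * r).
  by rewrite normrM ger0_norm ?expR_ge0 // ler_pM ?expR_ge0.
have t2 : `|expR x * (sin y - y)| <= 2 * (e' * r).
  by rewrite normrM ger0_norm ?expR_ge0 // ler_pM ?expR_ge0.
have t3 : `|(expR x - 1) * y| <= e' * r.
  rewrite normrM; apply: (@le_trans _ _ (2 * r * r)); first by rewrite ler_pM.
  by rewrite ler_wpM2r //; move: z4; rewrite -/r; lra.
have -> : expR x * cos y - 1 - x = expR x * (cos y - 1) + (expR x - 1 - x) by ring.
have -> : expR x * sin y - y = expR x * (sin y - y) + (expR x - 1) * y by ring.
have := ler_normD (expR x * (cos y - 1)) (expR x - 1 - x).
have := ler_normD (expR x * (sin y - y)) ((expR x - 1) * y).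
have : 6 * (e' * r) <= e * r by rewrite mulrA ler_wpM2r //; move: e'6; lra.
lra.
Qed.

Lemma derivable_cexp z : derivable cexp z 1.
Proof.
apply/derivable_cdiffP; exists (cexp z) => e e0.
have [d d0 hd] := cexp_slope0 (divr_gt0 e0 (expR_gt0 (complex.Re z))).
exists d => // w /hd.
have -> : cexp w - cexp z - (w - z) *: cexp z = cexp z * (cexp (w - z) - 1 - (w - z)).
  have -> : cexp w = cexp z * cexp (w - z) by rewrite -cexpD subrKC.
  by rewrite [_ *: _]mulrC !mulrBr mulr1.
rewrite rnormM rnorm_cexp mulrAC ler_pdivlMr ?expR_gt0 // => h.
by rewrite mulrC; exact: h.
Qed.
End Cexp.

(** * Goursat's theorem for dyadic sums *)

Section DyadicSums.
Variables (K : numFieldType) (V : lmodType K).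
Implicit Types (F G : K -> V) (w a b : K) (c L : V).

(* Average of [F] over the midpoints of the [2 ^ n] dyadic pieces of the segment
   from [w] to [w + a]. *)
Fixpoint dymean (n : nat) F w a : V :=
  if n is n'.+1 then (2^-1 : K) *: (dymean n' F w (a / 2) + dymean n' F (w + a / 2) (a / 2))
  else F (w + a / 2).

(* Riemann sum of [F] along the boundary of the parallelogram with corner [w]
   and sides [a], [b]. *)
Definition dyloop n F w a b : V :=
  a *: (dymean n F w a - dymean n F (w + b) a) + b *: (dymean n F (w + a) b - dymean n F w b).

Lemma halfK (z : K) : z / 2 + z / 2 = z.
Proof. by rewrite -mulrDr -div1r -mulrDl -[1 + 1]/(2%:R) divff ?mulr1 // pnatr_eq0. Qed.

Lemma dymeanB n F G w a :
  dymean n (fun z : K => F z - G z) w a = dymean n F w a - dymean n G w a.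
Proof.
elim: n w a => [|n IH] w a //=.
by rewrite !IH -scalerBr opprD addrACA.
Qed.

Lemma dymean_affine n c L w a :
  dymean n (fun z : K => c + z *: L) w a = c + (w + a / 2) *: L.
Proof.
elim: n w a => [|n IH] w a //=.
rewrite !IH addrACA -scalerDl scalerDr scalerA -mulr2n -(scaler_nat 2 c) scalerA.
rewrite mulVf ?pnatr_eq0 // scale1r; congr (c + _ *: L).
by field.
Qed.

(** Midpoint averages of affine functions are exact, so the sum vanishes at every level [n], not
    only in the limit. *)
Lemma dyloop_affine n c L w a b : dyloop n (fun z : K => c + z *: L) w a b = 0.
Proof.
have h (x y : V) : c + x - (c + y) = x - y by rewrite opprD addrACA subrr add0r.
rewrite /dyloop !dymean_affine !h -!scalerBl !scalerA -scalerDl.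
set x := (X in X *: L); have -> : x = 0 by rewrite /x; ring.
by rewrite scale0r.
Qed.

Lemma dyloopB n F G w a b : dyloop n (fun z : K => F z - G z) w a b = dyloop n F w a b - dyloop n G w a b.
Proof.
rewrite /dyloop !dymeanB [in RHS]opprD [RHS]addrACA -!scalerBr.
by congr (_ *: _ + _ *: _); rewrite !opprD !opprK addrACA.
Qed.

(** Cutting a parallelogram in four: [x], [y], [p], [q] are averages over the halves of the bottom,
    top, right and left sides, [m] and [n] over the inner edges, which are met twice with opposite
    signs. *)
Lemma grid_cancel (h k : K) (x1 x2 m1 m2 y1 y2 p1 p2 n1 n2 q1 q2 : V) :
  h *: (x1 + x2 - (y1 + y2)) + k *: (p1 + p2 - (q1 + q2)) =
  (h *: (x1 - m1) + k *: (n1 - q1)) + (h *: (x2 - m2) + k *: (p1 - n1)) +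
  ((h *: (m1 - y1) + k *: (n2 - q2)) + (h *: (m2 - y2) + k *: (p2 - n2))).
Proof.
have tel (x m y : V) : x - m + (m - y) = x - y by rewrite addrA subrK.
have tel' (x m y : V) : m - y + (x - m) = x - y by rewrite addrC tel.
have -> : x1 + x2 - (y1 + y2) = (x1 - m1) + (x2 - m2) + ((m1 - y1) + (m2 - y2)).
  by rewrite addrACA !tel opprD addrACA.
have -> : p1 + p2 - (q1 + q2) = (n1 - q1) + (p1 - n1) + ((n2 - q2) + (p2 - n2)).
  by rewrite !tel' opprD addrACA.
by rewrite !scalerDr addrACA; congr (_ + _); rewrite addrACA.
Qed.

Lemma dyloop_split n F w a b : dyloop n.+1 F w a b =
  dyloop n F w (a / 2) (b / 2) + dyloop n F (w + a / 2) (a / 2) (b / 2) +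
  (dyloop n F (w + b / 2) (a / 2) (b / 2) + dyloop n F (w + a / 2 + b / 2) (a / 2) (b / 2)).
Proof.
have hE x (u : V) : x *: ((2^-1 : K) *: u) = (x / 2) *: u by rewrite scalerA.
rewrite /dyloop /= -!scalerBr !hE; set h := a / 2; set k := b / 2.
have -> : b = k + k by rewrite halfK.
have -> : a = h + h by rewrite halfK.
rewrite !addrA.
have -> : w + h + k = w + k + h by rewrite addrAC.
have -> : w + h + h + k = w + k + h + h by rewrite addrAC (addrAC w).
have -> : w + k + k + h = w + k + h + k by rewrite addrAC.
rewrite (grid_cancel h k _ _ (dymean n F (w + k) h) (dymean n F (w + k + h) h) _ _ _ _
  (dymean n F (w + h) k) (dymean n F (w + k + h) k)).
by rewrite !addrA.
Qed.

Lemma dymean_translate n F w a u :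
  dymean n F (w + u) a = dymean n (fun z : K => F (z + u)) w a.
Proof.
elim: n w a => [|n IH] w a /=; first by rewrite addrAC.
by rewrite addrAC !IH.
Qed.

(** Each point of the first half is paired with its translate by half the segment; on a circle
    parametrized by [cexp] these are antipodal points. *)
Lemma dymean_fold n F w a :
  dymean n.+1 F w a = dymean n (fun z : K => (2^-1 : K) *: (F z + F (z + a / 2))) w (a / 2).
Proof.
rewrite [LHS]/= dymean_translate; move: (a / 2) {2 4}(a / 2) => b u.
elim: n w b => [|n IH] w b //=.
by rewrite -!IH -!scalerDr addrACA.
Qed.

(** This is how convexity enters: what is stable under midpoints passes from the values to the
    average. *)
Lemma dymean_ind (P : V -> Prop) n F w a :
  (forall u v, P u -> P v -> P ((2^-1 : K) *: (u + v))) ->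
  (forall t : K, 0 <= t <= 1 -> P (F (w + t * a))) -> P (dymean n F w a).
Proof.
move=> hP; elim: n w a => [|n IH] w a hF /=.
  by rewrite mulrC; apply: hF; rewrite invr_ge0 ler0n invf_le1 ?ltr0n // ler1n.
have h2 : 0 < 2 :> K by rewrite ltr0n.
apply: hP; apply: IH => t /andP[t0 t1].
  rewrite mulrA [t * a]mulrC -mulrA [a * _]mulrC; apply: hF.
  by rewrite divr_ge0 ?ler0n //= ler_pdivrMr // mul1r (le_trans t1) // ler1n.
have -> : w + a / 2 + t * (a / 2) = w + (1 + t) / 2 * a by field.
apply: hF; rewrite divr_ge0 ?addr_ge0 ?ler0n ?ler01 //= ler_pdivrMr // mul1r.
by rewrite -[2]/(1 + 1) lerD2l.
Qed.

End DyadicSums.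

Lemma nested_intervals (R : realType) (u v : nat -> R) :
  (forall k, u k <= u k.+1) -> (forall k, v k.+1 <= v k) -> (forall k, u k <= v k) ->
  exists x, forall k, u k <= x <= v k.
Proof.
move=> hu hv huv.
have mu j k : (j <= k)%N -> u j <= u k.
  by move=> jk; apply: (homo_leq (lexx) (@le_trans _ _)) jk => i; exact: hu.
have mv j k : (j <= k)%N -> v k <= v j.
  move=> /subnK <-; elim: (k - j)%N => [|i IH] //.
  by apply: le_trans IH; exact: hv.
have uv j k : u j <= v k.
  have [jk|/ltnW kj] := leqP j k; first exact: le_trans (mu _ _ jk) (huv k).
  exact: le_trans (huv j) (mv _ _ kj).
have hs : has_sup (range u).
  by split; [exists (u 0), 0%N | exists (v 0) => _ [j _ <-]].
exists (sup (range u)) => k; apply/andP; split.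
  by apply: sup_ubound; [exact: hs.2 | exists k].
by apply: sup_le_ub; [exact: hs.1 | move=> _ [j _ <-]].
Qed.

Lemma exp_half_small (R : realType) (e : R) : 0 < e -> exists k, 2^-1 ^+ k < e.
Proof.
move=> e0; have [k _ hk] := near_infty_natSinv_expn_lt (PosNum e0).
by exists k; have := hk k (leqnn k); rewrite /= exprVn div1r.
Qed.

Section Goursat.
Variables (R : realType) (V : normedModType R[i]).
Implicit Types (F : R[i] -> V) (w a b : R[i]).

Lemma dymean_bound n F w a (e : R) :
  (forall t : R, 0 <= t <= 1 -> rnorm (F (w + t%:C * a)) <= e) ->
  rnorm (dymean n F w a) <= e.
Proof.
move=> h; apply: (@dymean_ind _ _ (fun v => rnorm v <= e)).
  move=> u v hu hv; rewrite rnormZ rnormV.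
  have -> : rnorm (2 : R[i]^o) = 2.
    by have := @rnormC_ge0 R 2 (ler0n _ _); rewrite rmorph_nat.
  by rewrite mulrC ler_pdivrMr // mulr_natr mulr2n (le_trans (rnormD _ _)) // lerD.
move=> t /andP[t0 t1].
have ht : t = (complex.Re t)%:C by rewrite RRe_real // ger0_real.
by rewrite ht; apply: h; rewrite -(lecR 0) -(lecR _ 1) -ht t0 t1.
Qed.

Lemma dyloop_bound n F w a b (e : R) :
  (forall s t : R, 0 <= s <= 1 -> 0 <= t <= 1 -> rnorm (F (w + s%:C * a + t%:C * b)) <= e) ->
  rnorm (dyloop n F w a b) <= 2 * e * (rnorm (a : R[i]^o) + rnorm (b : R[i]^o)).
Proof.
move=> h; rewrite /dyloop.
have c0 : 0 <= (0 : R) <= 1 by rewrite lexx ler01.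
have c1 : 0 <= (1 : R) <= 1 by rewrite lexx ler01.
have e1 : rnorm (dymean n F w a) <= e.
  by apply: dymean_bound => s hs; have := h s 0 hs c0; rewrite mul0r addr0.
have e2 : rnorm (dymean n F (w + b) a) <= e.
  by apply: dymean_bound => s hs; have := h s 1 hs c1; rewrite mul1r addrAC.
have e3 : rnorm (dymean n F (w + a) b) <= e.
  by apply: dymean_bound => s hs; have := h 1 s c1 hs; rewrite mul1r.
have e4 : rnorm (dymean n F w b) <= e.
  by apply: dymean_bound => s hs; have := h 0 s c0 hs; rewrite mul0r addr0.
apply: le_trans (rnormD _ _) _; rewrite !rnormZ mulrDr.
by apply: lerD; rewrite mulrC ler_wpM2r ?rnorm_ge0 // (le_trans (rnormD _ _)) // rnormN;
  rewrite mulr_natl mulr2n lerD.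
Qed.

(** Bisection: a parallelogram whose sums do not become small relative to its area has a quarter
    with the same defect. Nested bad quarters shrink to a point near which [F] is almost affine, so
    that the sums are small after all. *)
Lemma goursat F w a b :
  (forall s t : R, 0 <= s <= 1 -> 0 <= t <= 1 ->
     derivable (F : R[i]^o -> V) (w + s%:C * a + t%:C * b) 1) ->
  forall e : R, 0 < e -> exists N, forall n, (N <= n)%N -> rnorm (dyloop n F w a b) <= e.
Proof.
move=> dF e e0.
pose q k : R := 2^-1 ^+ k.
have q0 k : 0 < q k by rewrite exprn_gt0 // invr_gt0.
have qS k : q k = q k.+1 + q k.+1 by rewrite /q exprS; field.
have qC k (c : R[i]) : (q k)%:C * c / 2 = (q k.+1)%:C * c.
  by rewrite qS rmorphD /=; field.
pose c s t := w + s%:C * a + t%:C * b.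
(* The bound is proportional to the area, which scales as [q k * q k], so four good quarters make a
   good parallelogram. *)
pose good k (p : R * R) := exists N, forall n, (N <= n)%N ->
  rnorm (dyloop n F (c p.1 p.2) ((q k)%:C * a) ((q k)%:C * b)) <= e * (q k * q k).
have [[N hN]|bad0] := EM (good 0%N (0, 0)).
  exists N => n /hN; rewrite /c /q /= expr0 !mulr1.
  by rewrite !mul0r !addr0 !mul1r.
pose child k (p p' : R * R) := (p'.1 = p.1 \/ p'.1 = p.1 + q k.+1) /\
                              (p'.2 = p.2 \/ p'.2 = p.2 + q k.+1).
have step k p : exists p', ~ good k p -> child k p p' /\ ~ good k.+1 p'.
  apply: contrapT => /forallNP H.
  have allg p' : child k p p' -> good k.+1 p'.
    by move=> hc; apply: contrapT => ng; apply: (H p').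
  have hbad : ~ good k p by move=> g; apply: (H p).
  apply: hbad; case: p allg {H} => s t allg.
  have [N1 h1] : good k.+1 (s, t) by apply: allg; split; left.
  have [N2 h2] : good k.+1 (s + q k.+1, t) by apply: allg; split; [right|left].
  have [N3 h3] : good k.+1 (s, t + q k.+1) by apply: allg; split; [left|right].
  have [N4 h4] : good k.+1 (s + q k.+1, t + q k.+1) by apply: allg; split; right.
  (* The successor is the level of subdivision consumed by [dyloop_split]. *)
  exists (maxn (maxn N1 N2) (maxn N3 N4)).+1 => -[//|n].
  rewrite ltnS !geq_max => /andP[/andP[n1 n2] /andP[n3 n4]].
  rewrite dyloop_split !qC.
  have -> : c (s, t).1 (s, t).2 + (q k.+1)%:C * a = c (s + q k.+1) t.
    by rewrite /c /= rmorphD /=; ring.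
  have -> : c (s, t).1 (s, t).2 + (q k.+1)%:C * b = c s (t + q k.+1).
    by rewrite /c /= rmorphD /=; ring.
  have -> : c (s + q k.+1) t + (q k.+1)%:C * b = c (s + q k.+1) (t + q k.+1).
    by rewrite /c /= rmorphD /=; ring.
  apply: le_trans (rnormD _ _) _.
  have -> : e * (q k * q k) = (e * (q k.+1 * q k.+1) + e * (q k.+1 * q k.+1)) +
     (e * (q k.+1 * q k.+1) + e * (q k.+1 * q k.+1)) by rewrite qS; ring.
  apply: lerD; apply: le_trans (rnormD _ _) _; apply: lerD.
  exact: h1.
  exact: h2.
  exact: h3.
  exact: h4.
have [g hg] : {g : nat -> R * R -> R * R |
    forall k p, ~ good k p -> child k p (g k p) /\ ~ good k.+1 (g k p)}.
  have [g hg] := @choice _ _ (fun (kp : nat * (R * R)) p' =>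
    ~ good kp.1 kp.2 -> child kp.1 kp.2 p' /\ ~ good kp.1.+1 p') (fun kp => step kp.1 kp.2).
  by exists (fun k p => g (k, p)) => k p; exact: (hg (k, p)).
pose P := fix P k := if k is k'.+1 then g k' (P k') else (0, 0) : R * R.
have badP k : ~ good k (P k) by elim: k => [|k IH] //=; exact: (hg k _ IH).2.
have chP k : child k (P k) (P k.+1) := (hg k _ (badP k)).1.
have lim1 (pr : R * R -> R) : (forall k, pr (P k.+1) = pr (P k) \/ pr (P k.+1) = pr (P k) + q k.+1) ->
    exists x, forall k, pr (P k) <= x <= pr (P k) + q k.
  move=> h; apply: nested_intervals => k.
  by case: (h k) => ->; rewrite ?lerDl // ltW.
  by have := q0 k.+1; case: (h k) => ->; rewrite (qS k); lra.
  by rewrite lerDl ltW.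
have [s hs] := lim1 (fun p => p.1) (fun k => (chP k).1).
have [t ht] := lim1 (fun p => p.2) (fun k => (chP k).2).
have := dF s t; have := hs 0%N; have := ht 0%N; rewrite /= !add0r /q expr0 => t01 s01.
move=> /(_ s01 t01)/derivable_cdiffP[L hL].
set l := rnorm (a : R[i]^o) + rnorm (b : R[i]^o).
have l0 : 0 <= l by rewrite addr_ge0 // rnorm_ge0.
(* With this tolerance [dyloop_bound], for sides of total length [q k * l], yields at most
   [e * (q k * q k)]; the [+ 1] covers [l = 0]. *)
have e20 : 0 < e / (2 * l * l + 1).
  by rewrite divr_gt0 // ltr_wpDl // !mulr_ge0.
have [d d0 hd] := hL _ e20.
have [k hk] := @exp_half_small R (d / (l + 1)) (divr_gt0 d0 (ltr_wpDl l0 ltr01)).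
exfalso; apply: (badP k); exists 0%N => n _.
set z0 := w + s%:C * a + t%:C * b in hL hd.
have -> : dyloop n F (c (P k).1 (P k).2) ((q k)%:C * a) ((q k)%:C * b) =
  dyloop n (fun z => F z - (F z0 - z0 *: L + z *: L)) (c (P k).1 (P k).2) ((q k)%:C * a) ((q k)%:C * b).
  by rewrite dyloopB dyloop_affine subr0.
have hq : q k * l < d.
  apply: le_lt_trans (_ : q k * (l + 1) < d); first by rewrite ler_wpM2l ?ltW // ltrDl.
  by rewrite -ltr_pdivlMr // ltr_wpDl.
apply: le_trans (@dyloop_bound n _ _ _ _ (e / (2 * l * l + 1) * (q k * l)) _) _; last first.
  rewrite !rnormM !rnormC_ge0 ?(ltW (q0 k)) // -mulrDr -/l.
  have -> : 2 * (e / (2 * l * l + 1) * (q k * l)) * (q k * l) =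
    e * (q k * q k) * (2 * l * l / (2 * l * l + 1)) by field; rewrite gt_eqF // ltr_wpDl // !mulr_ge0.
  rewrite ler_piMr // ?mulr_ge0 ?(ltW e0) ?(ltW (q0 k)) //.
  by rewrite ler_pdivrMr ?mul1r ?lerDl // ltr_wpDl // !mulr_ge0.
move=> s' t' hs' ht'; set z := (X in F X).
have nz : rnorm (z - z0 : R[i]^o) <= q k * l.
  have -> : z - z0 = ((P k).1 + s' * q k - s)%:C * a + ((P k).2 + t' * q k - t)%:C * b.
    by rewrite /z /z0 /c !rmorphB !rmorphD !rmorphM /=; ring.
  apply: le_trans (rnormD _ _) _; rewrite mulrDr !rnormM !rnormC.
  have bnd x y r : r <= x <= r + q k -> 0 <= y <= 1 -> `|r + y * q k - x| <= q k.
    move=> /andP[x1 x2] /andP[y0 y1]; rewrite ler_norml.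
    have : y * q k <= q k by rewrite ler_piMl // ltW.
    have : 0 <= y * q k by rewrite mulr_ge0 // ltW.
    by move=> ? ?; apply/andP; split; lra.
  by apply: lerD; rewrite ler_wpM2r ?rnorm_ge0 //; apply: bnd.
have -> : F z - (F z0 - z0 *: L + z *: L) = F z - F z0 - (z - z0) *: L.
  by rewrite scalerBl -[F z0 - _ + _]addrA [- _ + z *: L]addrC [- (F z0 + _)]opprD addrA.
by apply: le_trans (hd _ (le_lt_trans nz hq)) _; rewrite ler_wpM2l // ltW.
Qed.
End Goursat.

(** * Mean value property and maximum principle *)

Section MeanValue.
Variables (R : realType) (V : normedModType R[i]).
Implicit Types (h : R[i]^o -> V) (z w : R[i]^o).

(* In the coordinate [w], [z = z0 + exp w], the two horizontal sides of a period
   rectangle cancel by periodicity; Goursat's theorem then says that the averages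
   over two concentric circles agree in the limit. *)
Lemma mean_value h z0 (r : R) : 0 < r -> {for z0, continuous h} ->
  (forall z, 0 < rnorm (z - z0) <= r -> derivable h z 1) ->
  forall e : R, 0 < e -> exists N, forall n, (N <= n)%N ->
    rnorm (dymean n (fun w => h (z0 + cexp w)) (ln r)%:C (0 +i* (pi *+ 2)) - h z0) <= e.
Proof.
move=> r0 ch dh e e0.
set F : R[i] -> V := fun w => h (z0 + cexp w).
set b : R[i] := 0 +i* (pi *+ 2).
have b0 : 0 < rnorm (b : R[i]^o).
  apply: rnorm_gt0; rewrite eq_complex /= eqxx /= mulrn_eq0 /=.
  by rewrite gt_eqF // pi_gt0.
have Fb z : F (z + b) = F z.
  rewrite /F; congr (h (_ + _)).
  have -> : z + b = z + 0 +i* pi + 0 +i* pi.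
    by case: z => x y; apply/eqP; rewrite eq_complex /= !addr0 mulr2n addrA !eqxx.
  by rewrite !cexp_pi opprK.
have e20 : 0 < e / 2 by rewrite divr_gt0.
have [d d0 hd] := (iffLR (continuous_rnormP _ _) ch) _ e20.
pose rho := Num.min d r / 2.
have mdr : 0 < Num.min d r by rewrite lt_min d0.
have rho0 : 0 < rho by rewrite divr_gt0.
have rhoS : rho < Num.min d r by rewrite /rho; lra.
have [rhod rhor] : rho < d /\ rho < r by move: rhoS; rewrite lt_min => /andP[].
pose x0 := ln rho; pose a : R[i] := (ln r - x0)%:C.
have lnr : x0 < ln r by rewrite ltr_ln.
have bound (s t : R) : 0 <= s <= 1 -> complex.Re (x0%:C + s%:C * a + t%:C * b) <= ln r.
  move=> /andP[s0 s1]; rewrite /= !mul0r !mulr0 !subr0 addr0.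
  by rewrite -lerBrDl ler_piMl // subr_ge0 ltW.
have dF (s t : R) : 0 <= s <= 1 -> 0 <= t <= 1 ->
    derivable (F : R[i]^o -> V) (x0%:C + s%:C * a + t%:C * b) 1.
  move=> hs ht; set z := (X in derivable _ X).
  apply: (@derivable_comp _ _ h (fun w => z0 + cexp w)).
    by apply: derivableD; [exact: derivable_cst | exact: derivable_cexp].
  apply: dh; rewrite [z0 + _]addrC addrK rnorm_cexp expR_gt0 /=.
  apply: (@le_trans _ _ (expR (ln r))); last by rewrite lnK.
  by rewrite ler_expR; exact: (bound s t hs).
have e30 : 0 < e / 2 * rnorm (b : R[i]^o) by rewrite mulr_gt0.
have [N hN] := goursat dF e30.
exists N => n /hN; rewrite /dyloop dymean_translate.
have -> : (fun z : R[i] => F (z + b)) = F by apply/funext => z; exact: Fb.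
rewrite subrr scaler0 add0r rnormZ mulrC ler_pM2r //.
have -> : x0%:C + a = (ln r)%:C by rewrite /a -rmorphD /= subrKC.
set A := dymean _ _ _ _; set B := dymean _ _ _ _ => AB.
(* The inner circle has radius [rho < d], where [h] is within [e / 2] of [h z0]; the average stays
   in that ball. *)
have Bh : rnorm (B - h z0) <= e / 2.
  apply: (@dymean_ind _ _ (fun v => rnorm (v - h z0) <= e / 2)).
    move=> u v hu hv.
    have -> : (2^-1 : R[i]) *: (u + v) - h z0 = (2^-1 : R[i]) *: ((u - h z0) + (v - h z0)).
      rewrite addrACA -opprD [RHS]scalerBr -mulr2n -(scaler_nat 2 (h z0)) scalerA.
      by rewrite mulVf ?pnatr_eq0 // scale1r.
    have h2 : rnorm (2^-1 : R[i]^o) = 2^-1.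
      by have := @rnormC_ge0 R 2^-1; rewrite fmorphV rmorph_nat => ->.
    rewrite rnormZ h2 mulrC ler_pdivrMr // mulr_natr mulr2n (le_trans (rnormD _ _)) //.
    exact: lerD.
  move=> t /andP[t0 t1].
  have ht : t = (complex.Re t)%:C by rewrite RRe_real // ger0_real.
  apply/ltW/hd; rewrite [z0 + _]addrC addrK rnorm_cexp ht /= mul0r !mulr0 subr0 addr0.
  by rewrite lnK.
apply: le_trans (rnorm_tri _ B _) _.
by move: AB Bh; lra.
Qed.
End MeanValue.

Section MaxPrinciple.
Variables (R : realType) (V : normedModType R[i]).
Implicit Types (h : R[i]^o -> V) (z w : R[i]^o).

Lemma closed_disc_compact (r : R) : compact [set z : R[i]^o | rnorm z <= r].
Proof.
pose g (p : R * R) : R[i]^o := p.1 +i* p.2.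
have cg : continuous g.
  move=> p A /nbhs_rnormP[e e0 hA].
  exists (ball p.1 (e / 2), ball p.2 (e / 2)).
    by split; apply: nbhsx_ballx; rewrite divr_gt0.
  move=> q [/= q1 q2]; apply: hA; apply: le_lt_trans (rnorm_ReIm _) _ => /=.
  have -> : e = e / 2 + e / 2 by field.
  by apply: ltrD; rewrite distrC.
have ck : compact (g @` (`[- r, r] `*` `[- r, r])).
  apply: continuous_compact; first exact: continuous_subspaceT.
  by apply: compact_setX; exact: segment_compact.
apply: subclosed_compact ck _.
  move=> z /closure_rnormP hz /=; apply/ler_addgt0Pr => e e0.
  have [y /= yr yz] := hz e e0; rewrite -[z](subrKC y).
  by apply: le_trans (rnormD _ _) _; rewrite lerD // rnormB ltW.
move=> [x y] /= hz; exists (x, y) => //=; rewrite !in_itv /= -!ler_norml.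
by split; apply: le_trans hz; [exact: (rnorm_Re (x +i* y)) | exact: (rnorm_Im (x +i* y))].
Qed.

Lemma cont_real (f : R[i]^o -> R) z :
  (forall e : R, 0 < e -> exists2 d : R, 0 < d &
    forall w, rnorm (w - z) < d -> `|f w - f z| < e) -> {for z, continuous f}.
Proof.
move=> hf A /nbhs_ballP[e e0 hA]; have [d d0 hd] := hf e e0.
apply/nbhs_rnormP; exists d => // w /hd wz; apply: hA.
by rewrite /ball/= distrC.
Qed.

Lemma half_2pi : (0 +i* (pi *+ 2)) / 2 = 0 +i* pi :> R[i].
Proof.
apply: (@mulIf _ 2); first by rewrite pnatr_eq0.
rewrite divfK ?pnatr_eq0 // mulr_natr !mulr2n; apply/eqP.
by rewrite eq_complex /= addr0 !eqxx.
Qed.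

(* A maximum point [z0] of [N (h z) + eps |z|^2] inside the disc would contradict
   the mean value property on a small circle around [z0], where the average of
   [|z|^2] over antipodal points exceeds [|z0|^2] by the square of the radius. *)
Lemma max_principle (N : V -> R) h (r m : R) : 0 < r ->
  (forall u v, `|N u - N v| <= rnorm (u - v)) ->
  (forall u v, N ((2^-1 : R[i]) *: (u + v)) <= (N u + N v) / 2) ->
  (forall z, rnorm z <= r -> {for z, continuous h}) ->
  (forall z, 0 < rnorm z < r -> derivable h z 1) ->
  (forall z, rnorm z = r -> N (h z) <= m) ->
  forall z, rnorm z <= r -> N (h z) <= m.
Proof.
move=> r0 lipN cvxN ch dh bdy z1 z1r; rewrite leNgt; apply/negP => gtm.
(* On the circle of radius [r] the added term is then half of [N (h z1) - m], so [Phi] is smaller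
   there than at [z1]. *)
pose eps := (N (h z1) - m) / (2 * r ^+ 2).
have eps0 : 0 < eps by rewrite divr_gt0 ?subr_gt0 // mulr_gt0 // exprn_gt0.
pose Phi z := N (h z) + eps * rnorm z ^+ 2.
have cPhi z : rnorm z <= r -> {for z, continuous Phi}.
  move=> zr; have /continuous_rnormP cz := ch z zr.
  have cn : {for z, continuous (fun w : R[i]^o => rnorm w)}.
    apply: cont_real => e e0; exists e => // w wz.
    apply: le_lt_trans wz; rewrite ler_norml.
    by have := rnorm_tri w z 0; have := rnorm_tri z w 0; rewrite !subr0 (rnormB z w) => *;
      apply/andP; split; lra.
  have cN : {for z, continuous (N \o h)}.
    apply: cont_real => e e0; have [d d0 hd] := cz e e0.
    by exists d => // w wz; apply: le_lt_trans (lipN _ _) (hd _ wz).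
  apply: (continuousD cN); apply: continuousM; first exact: cst_continuous.
  exact: (continuousM cn cn).
have [z0 z0r maxz0] : exists2 z0, rnorm z0 <= r & forall z, rnorm z <= r -> Phi z <= Phi z0.
  have [||z0 z0A hz0] := @compact_EVT_max _ R Phi _ _ (@closed_disc_compact r).
    by exists z1.
    by apply: continuous_in_subspaceT => z /set_mem /cPhi.
  exists z0; first exact: (set_mem z0A).
  by move=> z zr; apply: hz0; exact: mem_set.
have z0lt : rnorm z0 < r.
  rewrite lt_neqAle z0r andbT; apply/eqP => z0E.
  have := maxz0 _ z1r; rewrite /Phi z0E => le1.
  have := bdy _ z0E.
  have e1 : eps * r ^+ 2 = (N (h z1) - m) / 2 by rewrite /eps; field; rewrite gt_eqF.
  have : 0 <= eps * rnorm z1 ^+ 2 by rewrite mulr_ge0 ?(ltW eps0) // sqr_ge0.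
  by move: le1; rewrite e1; lra.
(* As [h] is differentiable only off the origin, the small disc must avoid 0 unless it is centred
   there. *)
have [s s0 [sr hs]] : exists2 s : R, 0 < s & rnorm z0 + s < r /\
    forall z, 0 < rnorm (z - z0) <= s -> 0 < rnorm z < r.
  pose s := (if z0 == 0 then r else Num.min (rnorm z0) (r - rnorm z0)) / 2.
  have s0 : 0 < s.
    rewrite /s divr_gt0 //; case: eqP => // /eqP z00.
    by rewrite lt_min rnorm_gt0 //= subr_gt0.
  have sr : rnorm z0 + s < r.
    rewrite /s; case: eqP => [->|_]; first by rewrite rnorm0; lra.
    have : Num.min (rnorm z0) (r - rnorm z0) <= r - rnorm z0 by rewrite ge_min lexx orbT.
    by lra.
  exists s => //; split=> // z /andP[z00 zs]; apply/andP; split; last first.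
    apply: le_lt_trans sr; rewrite -[z](subrKC z0).
    by apply: le_trans (rnormD _ _) _; rewrite lerD2l.
  have [z0E|z0E] := eqVneq z0 0; first by move: z00; rewrite z0E subr0.
  have : s < rnorm z0.
    rewrite /s (negbTE z0E).
    have : Num.min (rnorm z0) (r - rnorm z0) <= rnorm z0 by rewrite ge_min lexx.
    by have := rnorm_gt0 z0E; lra.
  have := rnorm_tri z0 z 0; rewrite !subr0 (rnormB z0).
  by lra.
have e0 : 0 < eps * s ^+ 2 / 2 by rewrite divr_gt0 // mulr_gt0 // exprn_gt0.
have [M hM] := mean_value s0 (ch _ z0r) (fun z hz => dh z (hs z hz)) e0.
(* Folding into antipodal pairs takes at least one level of subdivision. *)
have := hM M.+1 (leqnSn _).
rewrite dymean_fold; set F := (fun _ : R[i] => _); set X := dymean _ _ _ _.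
have NX : N X <= N (h z0) - eps * s ^+ 2.
  apply: (@dymean_ind _ _ (fun v => N v <= N (h z0) - eps * s ^+ 2)).
    by move=> u v hu hv; apply: le_trans (cvxN _ _) _; lra.
  move=> t /andP[t0 t1].
  have ht : t = (complex.Re t)%:C by rewrite RRe_real // ger0_real.
  set w := (X in F X).
  have rw : complex.Re w = ln s.
    have -> : w = (ln s)%:C + (complex.Re t)%:C * (0 +i* pi).
      by rewrite /w ht half_2pi.
    by rewrite /= mul0r mulr0 subr0 addr0.
  have nE : rnorm (cexp w) = s by rewrite rnorm_cexp rw lnK.
  have -> : F w = (2^-1 : R[i]) *: (h (z0 + cexp w) + h (z0 - cexp w)).
    by rewrite /F half_2pi cexp_pi.
  have in1 : rnorm (z0 + cexp w) <= r.
    by apply: le_trans (rnormD _ _) _; rewrite nE ltW.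
  have in2 : rnorm (z0 - cexp w) <= r.
    by apply: le_trans (rnormD _ _) _; rewrite rnormN nE ltW.
  have := maxz0 _ in1; have := maxz0 _ in2; have := cvxN (h (z0 + cexp w)) (h (z0 - cexp w)).
  rewrite /Phi.
  have par : rnorm (z0 + cexp w) ^+ 2 + rnorm (z0 - cexp w) ^+ 2 = 2 * (rnorm z0 ^+ 2 + s ^+ 2).
    rewrite -nE !rnorm_sqr; move: (cexp w) => [p q]; case: (z0) => x y /=; ring.
  have : eps * (rnorm (z0 + cexp w) ^+ 2 + rnorm (z0 - cexp w) ^+ 2) =
     2 * (eps * rnorm z0 ^+ 2) + 2 * (eps * s ^+ 2) by rewrite par; ring.
  rewrite mulrDr; lra.
move=> hX; have := lipN X (h z0); rewrite ler_norml => /andP[h1 h2].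
by move: e0 hX h1 NX; lra.
Qed.
End MaxPrinciple.

(** * Maximum principle for convex sets, Schwarz's lemma, Harnack's inequality *)

Section ConvexMaxPrinciple.
Variables (R : realType) (V : normedModType R[i]).
Implicit Types (h phi : R[i]^o -> V) (A D : set V).

Definition cvx D := forall u v (s : R), D u -> D v -> 0 <= s <= 1 ->
  D (s%:C *: u + (1 - s)%:C *: v).

Definition setdist A (v : V) : R := inf [set rnorm (v - a) | a in A].

Lemma has_inf_setdist A v : A !=set0 -> has_inf [set rnorm (v - a) | a in A].
Proof.
by move=> [a Aa]; split; [exists (rnorm (v - a)), a | exists 0 => _ [b _ <-]; exact: rnorm_ge0].
Qed.

Lemma setdist_approx A v (e : R) : A !=set0 -> 0 < e ->
  exists2 a, A a & rnorm (v - a) < setdist A v + e.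
Proof.
move=> A0 e0; have [_ [a Aa <-] h] := inf_adherent e0 (has_inf_setdist v A0).
by exists a.
Qed.

Lemma setdist_le A v a : A a -> setdist A v <= rnorm (v - a).
Proof.
move=> Aa; apply: ge_inf; last by exists a.
by exists 0 => _ [b _ <-]; exact: rnorm_ge0.
Qed.

Lemma setdist_lip A u v : A !=set0 -> `|setdist A u - setdist A v| <= rnorm (u - v).
Proof.
move=> A0.
have h x y : setdist A x <= setdist A y + rnorm (x - y).
  apply/ler_addgt0Pr => e e0; have [a Aa ha] := setdist_approx y A0 e0.
  apply: le_trans (setdist_le x Aa) _; apply: le_trans (rnorm_tri _ y _) _.
  by rewrite addrC addrAC lerD2r ltW.
rewrite ler_norml; have := h u v; have := h v u; rewrite (rnormB v u) => ? ?.
by apply/andP; split; lra.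
Qed.

Lemma rnorm_half (v : V) : rnorm ((2^-1 : R[i]) *: v) = rnorm v / 2.
Proof.
rewrite (@rnormZ _ V (2^-1 : R[i]^o)) mulrC; congr (_ * _).
by have := @rnormC_ge0 R 2^-1; rewrite fmorphV rmorph_nat => ->.
Qed.

Lemma setdist_mid A u v : cvx A -> A !=set0 ->
  setdist A ((2^-1 : R[i]) *: (u + v)) <= (setdist A u + setdist A v) / 2.
Proof.
move=> cA A0; apply/ler_addgt0Pr => e e0.
have [a Aa ha] := setdist_approx u A0 e0; have [b Ab hb] := setdist_approx v A0 e0.
have : A ((2^-1 : R[i]) *: (a + b)).
  have := cA a b 2^-1 Aa Ab; rewrite scalerDr.
  have -> : 1 - 2^-1 = 2^-1 :> R by field.
  rewrite fmorphV rmorph_nat; apply.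
  by rewrite invr_ge0 ler0n invf_le1 // ler1n.
move=> /setdist_le; set w := _ *: (u + v) => /(_ w)/le_trans; apply.
rewrite /w -scalerBr rnorm_half opprD addrACA.
have := rnormD (u - a) (v - b); lra.
Qed.

Lemma setdist0 A v : A !=set0 -> setdist A v <= 0 -> closure A v.
Proof.
move=> A0 h; apply/closure_rnormP => e e0; have [a Aa ha] := setdist_approx v A0 e0.
by exists a => //; rewrite rnormB; lra.
Qed.

Lemma setdist_closure A v : closure A v -> setdist A v <= 0.
Proof.
move=> /closure_rnormP h; apply/ler_addgt0Pr => e e0; have [a Aa ha] := h e e0.
by rewrite add0r (le_trans (setdist_le v Aa)) // rnormB ltW.
Qed.

(** The distance to a convex set is 1-Lipschitz and midpoint convex, and it vanishes exactly on the
    closure. *)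
Lemma max_principle_convex A h (r : R) : 0 < r -> cvx A -> A !=set0 ->
  (forall z, rnorm z <= r -> {for z, continuous h}) ->
  (forall z, 0 < rnorm z < r -> derivable h z 1) ->
  (forall z, rnorm z = r -> closure A (h z)) ->
  forall z, rnorm z <= r -> closure A (h z).
Proof.
move=> r0 cA A0 ch dh bd z zr; apply: setdist0 => //.
apply: (max_principle r0 (N := setdist A) (h := h)) zr => //.
by move=> u v; exact: setdist_lip.
by move=> u v; exact: setdist_mid.
by move=> w /bd /setdist_closure.
Qed.

Lemma derivable_near_eq (F G : R[i]^o -> V) (z : R[i]^o) (d : R) : 0 < d ->
  (forall w, rnorm (w - z) < d -> F w = G w) -> derivable F z 1 -> derivable G z 1.
Proof.
move=> d0 FG /derivable_cdiffP[L hL]; apply/derivable_cdiffP; exists L => e e0.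
have [d' d'0 hd'] := hL e e0; exists (Num.min d d'); first by rewrite lt_min d0.
move=> w; rewrite lt_min => /andP[w1 w2]; rewrite -!FG ?subrr ?rnorm0 //.
exact: hd'.
Qed.

(** The regularity obtained, continuity at 0 and differentiability elsewhere, is what
    [max_principle] asks for. *)
Lemma difference_quotient phi (r : R) : 0 < r ->
  (forall z, rnorm z <= r -> derivable phi z 1) ->
  exists q : R[i]^o -> V, [/\ forall z, phi z = phi 0 + z *: q z,
    forall z, rnorm z <= r -> {for z, continuous q} &
    forall z, 0 < rnorm z <= r -> derivable q z 1].
Proof.
move=> r0 dphi.
have /dphi/derivable_slopeP[q [cq hq]] : rnorm (0 : R[i]^o) <= r by rewrite rnorm0 ltW.
have hq' z : phi z = phi 0 + z *: q z by rewrite [LHS]hq subr0.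
have dq z : 0 < rnorm z <= r -> derivable q z 1.
  move=> /andP[z0 zr].
  apply: (@derivable_near_eq (fun w => w^-1 *: (phi w - phi 0)) q z _ z0).
    move=> w wz; rewrite hq' [phi 0 + _]addrC addrK scalerA mulVf ?scale1r //.
    by apply/eqP => w0; move: wz; rewrite w0 sub0r rnormN ltxx.
  apply: derivable_scale.
    apply: derivableV; last exact: derivable_id.
    by apply/eqP => z00; move: z0; rewrite z00 rnorm0 ltxx.
  by apply: derivableB; [exact: dphi | exact: derivable_cst].
exists q; split=> // z zr; have [->|z0] := eqVneq z 0; first exact: cq.
by apply: derivable_cont; apply: dq; rewrite rnorm_gt0.
Qed.

(** The difference quotient is bounded by its values on the circle, where the numerator is at most
    [2 * M]. *)
Lemma schwarz phi (r M : R) : 0 < r ->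
  (forall z, rnorm z <= r -> derivable phi z 1) ->
  (forall z, rnorm z <= r -> rnorm (phi z) <= M) ->
  forall z, rnorm z <= r -> rnorm (phi z - phi 0) <= 2 * M / r * rnorm z.
Proof.
move=> r0 dphi bphi; have [q [hq cq dq]] := difference_quotient r0 dphi.
have bq : forall z, rnorm z <= r -> rnorm (q z) <= 2 * M / r.
  apply: (max_principle r0 (N := @rnorm R V) (h := q)) => //.
  move=> u v; rewrite ler_norml; have := rnorm_tri u v 0; have := rnorm_tri v u 0.
    by rewrite !subr0 (rnormB v u) => ? ?; apply/andP; split; lra.
  by move=> u v; rewrite rnorm_half ler_pM2r ?invr_gt0 // rnormD.
  by move=> z /andP[z0 zr]; apply: dq; rewrite z0 ltW.
  move=> z zr; rewrite ler_pdivlMr // mulrC -zr -rnormZ.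
  have -> : z *: q z = phi z - phi 0 by rewrite [phi z]hq [phi 0 + _]addrC addrK.
  apply: le_trans (rnormD _ _) _; rewrite rnormN mulr_natl mulr2n.
  by apply: lerD; apply: bphi; rewrite ?zr // rnorm0 ltW.
move=> z zr; rewrite hq [phi 0 + _]addrC addrK rnormZ mulrC.
by rewrite ler_wpM2r ?rnorm_ge0 // bq.
Qed.

(* Harnack's inequality. On the unit circle, [(1 + z)^2 / (4 z) = (1 + Re z) / 2]
   lies in [0, 1], so [h z = p + (1 + z)^2 / (4 z) *: (phi z - p)] maps the circle,
   hence the disc, to the closure of [D]. *)
Lemma harnack D phi (c : R) : cvx D -> 0 < c < 1 ->
  (forall z, rnorm z <= 1 -> derivable phi z 1) ->
  (forall z, rnorm z <= 1 -> D (phi z)) ->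
  exists2 y, closure D y &
    let b := ((1 - c) / (1 + c)) ^+ 2 in phi c%:C = (1 - b)%:C *: y + b%:C *: phi 0.
Proof.
move=> cD /andP[c0 c1] dphi Dphi; have [q [hq cq dq]] := difference_quotient ltr01 dphi.
pose a (z : R[i]^o) : R[i]^o := (1 + z) ^+ 2 / 4.
pose h z := phi 0 + a z *: q z.
have da z : derivable a z 1.
  have d1 : derivable (fun w : R[i]^o => 1 + 1 * w : R[i]^o) z 1 by exact: derivable_lin.
  have d2 : derivable (fun w : R[i]^o => (1 + 1 * w) * (1 + 1 * w) : R[i]^o) z 1.
    exact: (derivable_scale d1 d1).
  have d3 := derivable_scale (@derivable_lin R 0 4^-1 z) d2.
  have -> : a = (fun w : R[i]^o => (4^-1 + 0 * w) *: ((1 + 1 * w) * (1 + 1 * w)) : R[i]^o).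
    by apply/funext => w; rewrite /a mul0r addr0 mul1r mulrC expr2.
  exact: d3.
have hD z : rnorm z <= 1 -> closure D (h z).
  apply: (max_principle_convex ltr01 cD).
  by exists (phi 0); apply: Dphi; rewrite rnorm0.
  move=> w w1; apply: continuousD; first exact: cst_continuous.
    exact: (@cvgZ R[i] V R[i]^o (nbhs w) _ a q _ _ (derivable_cont (da w)) (cq w w1)).
  move=> w /andP[w0 w1]; apply: derivableD; first exact: derivable_cst.
    by apply: derivable_scale => //; apply: dq; rewrite w0 ltW.
  move=> w w1; apply: subset_closure.
  pose t := (1 + complex.Re w) / 2.
  have t01 : 0 <= t <= 1.
    have := rnorm_Re w; rewrite w1 ler_norml => /andP[m1 m2].
    by rewrite /t; apply/andP; split; lra.
  have aw : a w = t%:C * w.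
    have := rnorm_sqr w; rewrite w1 expr1n /a /t; case: (w) => x y /= e1.
    apply: (@mulIf _ 4); first by rewrite pnatr_eq0.
    rewrite divfK ?pnatr_eq0 //; apply/eqP; rewrite eq_complex expr2 /=.
    have -> : (0 + y) * (0 + y) = 1 - x ^+ 2 by rewrite e1; ring.
    by apply/andP; split; apply/eqP; field.
  have -> : h w = t%:C *: phi w + (1 - t)%:C *: phi 0.
    rewrite /h aw (hq w) scalerDr scalerA [RHS]addrAC -(scalerDl (phi 0)) -rmorphD /=.
    by rewrite subrKC scale1r.
  by apply: cD => //; apply: Dphi; rewrite ?w1 // rnorm0.
exists (h c%:C); first by apply: hD; rewrite rnormC_ge0 ltW.
rewrite /h; set b := _ ^+ 2.
have ac : a c%:C = ((1 + c) ^+ 2 / 4)%:C.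
  by rewrite /a rmorphM /= fmorphV rmorphXn /= rmorphD /= rmorph_nat rmorph1.
(* This identity dictates [b]: the coefficient of the quotient in [h c%:C], times [1 - b], has to be
   [c]. *)
have bE : (1 - b) * ((1 + c) ^+ 2 / 4) = c.
  by rewrite /b; field; rewrite gt_eqF // addr_gt0.
rewrite (hq c%:C) ac scalerDr scalerA -rmorphM /= bE [RHS]addrAC -(scalerDl (phi 0)).
by rewrite -rmorphD /= subrK scale1r.
Qed.

End ConvexMaxPrinciple.

(** * Analytic discs and chains *)

Section Artanh.
Variable R : realType.

Lemma artanh_lt (x y : R) : 0 <= x -> x < y -> y < 1 -> artanh x < artanh y.
Proof.
move=> x0 xy y1; rewrite /artanh ltr_pM2r ?invr_gt0 //.
have x1 : x < 1 := lt_trans xy y1.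
have px : 0 < 1 - x by rewrite subr_gt0.
have py : 0 < 1 - y by rewrite subr_gt0.
have y0 : 0 <= y by rewrite ltW // (le_lt_trans x0).
have px1 : 0 < 1 + x by lra.
have py1 : 0 < 1 + y by lra.
rewrite ltr_ln ?posrE ?divr_gt0 //.
by rewrite ltr_pdivrMr // mulrAC ltr_pdivlMr //; lra.
Qed.

Lemma artanh_unbounded (m : R) : exists2 c : R, 0 < c < 1 & m < artanh c.
Proof.
(* The witness below is the hyperbolic tangent of [k / 2]. *)
pose k := 2 * (`|m| + 1); pose t := expR k.
have k0 : 0 < k by rewrite mulr_gt0 // ltr_wpDl.
have t1 : 1 < t by rewrite expR_gt1.
have tp : 0 < t + 1 by rewrite addr_gt0 // (lt_trans ltr01).
exists ((t - 1) / (t + 1)).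
  by rewrite divr_gt0 ?subr_gt0 //= ltr_pdivrMr // mul1r; lra.
have -> : artanh ((t - 1) / (t + 1)) = `|m| + 1.
  rewrite /artanh; have -> : (1 + (t - 1) / (t + 1)) / (1 - (t - 1) / (t + 1)) = t.
    by field; rewrite gt_eqF //=; apply/eqP; lra.
  by rewrite expRK /k; field.
by rewrite ltr_pwDr // ler_norm.
Qed.
End Artanh.

Section Kobayashi.
Variables (R : realType) (V : normedModType R[i]) (D : set V).
Implicit Types (x y u v : V) (c r s : R) (n m : nat).

(* Analytic discs that extend past the closed unit disc; by a dilation and a
   rotation the second point is the image of a positive real. *)
Definition adisc c x y := exists phi : R[i]^o -> V,
  [/\ forall z, rnorm z <= 1 -> derivable phi z 1,
      forall z, rnorm z <= 1 -> D (phi z), phi 0 = x & phi c%:C = y].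

Lemma adisc_le c c' x y : 0 < c -> c <= c' -> adisc c x y -> adisc c' x y.
Proof.
move=> c0 cc' [phi [dphi Dphi phi0 phic]].
have c'0 : 0 < c' := lt_le_trans c0 cc'.
have q0 : 0 <= c / c' by rewrite divr_ge0 // ltW.
have q1 : c / c' <= 1 by rewrite ler_pdivrMr // mul1r.
have le1 (z : R[i]^o) : rnorm z <= 1 -> rnorm (0 + (c / c')%:C * z : R[i]^o) <= 1.
  move=> z1; rewrite add0r rnormM rnormC_ge0 // -[1]mul1r.
  by rewrite ler_pM ?rnorm_ge0.
exists (fun z => phi (0 + (c / c')%:C * z)); split.
by move=> z z1; apply: derivable_comp; [exact: derivable_lin | exact/dphi/le1].
by move=> z z1; exact/Dphi/le1.
by rewrite mulr0 addr0.
by rewrite add0r -rmorphM /= divfK // gt_eqF.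
Qed.

Lemma kobayashi_lt_adisc c x y : 0 < c < 1 ->
  (kobayashi_dist D x y < (artanh c)%:E)%E -> exists2 c', 0 < c' < c & adisc c' x y.
Proof.
move=> /andP[c0 c1] /ereal_inf_lt[_ [g [g1 [phi [[Dphi dphi] phi0 phig]]] <-]].
rewrite lte_fin poincare_dist0 => lt.
have gc : rnorm g < c.
  rewrite ltNge le_eqVlt; apply/negP => /orP[/eqP e|h].
    by move: lt; rewrite e ltxx.
  by have := lt_trans lt (artanh_lt (ltW c0) h g1); rewrite ltxx.
have g0 := rnorm_ge0 g.
(* As [rnorm g < c'], multiplication by [g / c'] maps the closed unit disc into the open one. *)
pose c' := (rnorm g + c) / 2.
have c'0 : 0 < c' by rewrite /c'; lra.
exists c'; first by rewrite c'0 /=; rewrite /c'; lra.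
have gc' : rnorm (g / c'%:C : R[i]^o) < 1.
  rewrite rnormM rnormV rnormC_ge0 ?ltW // ltr_pdivrMr // mul1r /c'; lra.
have lt1 (z : R[i]^o) : rnorm z <= 1 -> unit_disc (0 + g / c'%:C * z : R[i]^o).
  move=> z1; rewrite /unit_disc /= add0r rnormM; apply: le_lt_trans gc'.
  by rewrite ler_piMr // rnorm_ge0.
exists (fun z => phi (0 + g / c'%:C * z)); split.
by move=> z z1; apply: derivable_comp; [exact: derivable_lin | exact/dphi/lt1].
by move=> z z1; exact/Dphi/lt1.
by rewrite mulr0 addr0.
by rewrite add0r divfK ?phig //; apply/eqP; case=> e; move: c'0; rewrite e ltxx.
Qed.

Lemma adisc_kobayashi_le c x y : 0 < c < 1 -> adisc c x y ->
  (kobayashi_dist D x y <= (artanh c)%:E)%E.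
Proof.
move=> /andP[c0 c1] [phi [dphi Dphi phi0 phic]]; apply: ereal_inf_lbound.
exists (c%:C : R[i]^o); last by rewrite poincare_dist0 rnormC_ge0 // ltW.
split; first by rewrite /unit_disc /= rnormC_ge0 // ltW.
exists phi; split => //; split; first by move=> z z1; exact/Dphi/ltW.
by move=> z z1; exact/dphi/ltW.
Qed.

(** Discs in both directions make the relation symmetric by construction; [c' < c] matches a strict
    inequality of distances. *)
Definition near c x y := exists2 c', 0 < c' < c & adisc c' x y /\ adisc c' y x.

Lemma nearP c x y : 0 < c < 1 -> near c x y <->
  (kobayashi_dist D x y < (artanh c)%:E)%E /\ (kobayashi_dist D y x < (artanh c)%:E)%E.
Proof.
move=> hc; have /andP[c0 c1] := hc; split.
  move=> [c' /andP[c'0 c'c] [h1 h2]]; have lt := artanh_lt (ltW c'0) c'c c1.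
  have hc' : 0 < c' < 1 by rewrite c'0 (lt_trans c'c).
  by split; (apply: le_lt_trans (adisc_kobayashi_le hc' _) _; [|rewrite lte_fin]).
move=> [/(kobayashi_lt_adisc hc)[a /andP[a0 ac] ha] /(kobayashi_lt_adisc hc)[b /andP[b0 bc] hb]].
exists (Num.max a b); first by rewrite lt_max a0 gt_max ac bc.
by split; [apply: (adisc_le a0 _ ha) | apply: (adisc_le b0 _ hb)]; rewrite le_max lexx ?orbT.
Qed.

Lemma near_sym c x y : near c x y -> near c y x.
Proof. by move=> [c' hc' [h1 h2]]; exists c'. Qed.

Lemma near_refl c x : 0 < c -> D x -> near c x x.
Proof.
move=> c0 Dx; have h : adisc (c / 2) x x.
  by exists (fun=> x); split=> // z _; exact: derivable_cst.
by exists (c / 2); [apply/andP; split; lra | split].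
Qed.

Lemma adisc_cvx c s x y (z w : V) : cvx D -> 0 <= s <= 1 -> adisc c x y -> adisc c z w ->
  adisc c (s%:C *: x + (1 - s)%:C *: z) (s%:C *: y + (1 - s)%:C *: w).
Proof.
move=> cD hs [f [df Df f0 fc]] [g [dg Dg g0 gc]].
exists (fun t => s%:C *: f t + (1 - s)%:C *: g t); split.
by move=> t t1; apply: derivableD; apply: derivable_scalel; [exact: df | exact: dg].
by move=> t t1; apply: cD => //; [exact: Df | exact: Dg].
by rewrite f0 g0.
by rewrite fc gc.
Qed.

Lemma near_cvx c s x y (z w : V) : cvx D -> 0 <= s <= 1 -> near c x y -> near c z w ->
  near c (s%:C *: x + (1 - s)%:C *: z) (s%:C *: y + (1 - s)%:C *: w).
Proof.
move=> cD hs [a /andP[a0 ac] [h1 h2]] [b /andP[b0 bc] [h3 h4]].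
exists (Num.max a b); first by rewrite lt_max a0 gt_max ac bc.
have la : a <= Num.max a b by rewrite le_max lexx.
have lb : b <= Num.max a b by rewrite le_max lexx orbT.
by split; apply: adisc_cvx => //; [exact: adisc_le h1 | exact: adisc_le h3 |
  exact: adisc_le h2 | exact: adisc_le h4].
Qed.

Definition inball x r := forall v, rnorm (v - x) < r -> D v.

(** The affine disc through both points, with the second at parameter [c'], has radius
    [l / c' < r]. *)
Lemma near_small c x y r : 0 < c -> 0 < r -> inball x r -> inball y r ->
  rnorm (y - x) < r * c -> near c x y.
Proof.
move=> c0 r0; set l := rnorm (y - x) => bx by_ lc.
have l0 : 0 <= l := rnorm_ge0 _.
pose c' := (l / r + c) / 2.
have lr : l / r < c by rewrite ltr_pdivrMr // mulrC.
have lr0 : 0 <= l / r by rewrite divr_ge0 // ltW.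
have c'0 : 0 < c' by rewrite /c'; lra.
have lc' : l < r * c' by rewrite mulrC -ltr_pdivrMr // /c'; lra.
have key u v : inball u r -> rnorm (v - u) = l -> adisc c' u v.
  move=> bu uv; exists (fun z => u + (0 + c'%:C^-1 * z : R[i]^o) *: (v - u)); split.
  move=> z z1; apply: derivableD; first exact: derivable_cst.
    by apply: derivable_scaler; exact: derivable_lin.
  move=> z z1; apply: bu; rewrite [u + _]addrC addrK rnormZ add0r rnormM rnormV.
    rewrite rnormC_ge0 ?(ltW c'0) // uv mulrC mulrA.
    apply: le_lt_trans (_ : l / c' < r); first by rewrite ler_piMr // divr_ge0 // ltW.
    by rewrite ltr_pdivrMr.
  by rewrite mulr0 addr0 scale0r addr0.
  rewrite add0r mulVf ?scale1r ?subrKC //.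
    by apply/eqP; case=> e; move: c'0; rewrite e ltxx.
exists c'; first by rewrite c'0 /= /c'; lra.
by split; apply: key => //; rewrite rnormB.
Qed.

Lemma near_norm c x y (M : R) : (forall v, D v -> rnorm v <= M) -> c <= 1 ->
  near c x y -> rnorm (y - x) <= 2 * M * c.
Proof.
move=> bD c1 [c' /andP[c'0 c'c] [[phi [dphi Dphi <- <-]] _]].
have M0 : 0 <= M by apply: le_trans (bD _ (Dphi 0 _)); rewrite ?rnorm_ge0 ?rnorm0.
have := schwarz ltr01 dphi (fun z hz => bD _ (Dphi z hz)) (z := c'%:C).
rewrite rnormC_ge0 ?(ltW c'0) // divr1 => h; apply: le_trans (h _) _.
  by rewrite ltW // (lt_le_trans c'c).
by rewrite ler_wpM2l ?mulr_ge0 // ltW.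
Qed.

End Kobayashi.

(** * Chains of short Kobayashi steps *)

Section Links.
Variables (R : realType) (V : normedModType R[i]) (D : set V).
Hypotheses (oD : open D) (scD : strictly_convex D).
Implicit Types (x y u v w : V) (s r : R) (n m : nat).

Lemma comb_self s v : s%:C *: v + (1 - s)%:C *: v = v.
Proof. by rewrite -scalerDl -rmorphD /= subrKC scale1r. Qed.

Lemma strict_mix x y s : closure D x -> D y -> 0 < s < 1 -> D (s%:C *: x + (1 - s)%:C *: y).
Proof.
move=> Dx Dy hs; have [->|/eqP xy] := eqVneq x y; first by rewrite comb_self.
exact: (scD Dx (subset_closure Dy) xy).
Qed.

Lemma strictly_convex_cvx : cvx D.
Proof.
move=> u v s Du Dv /andP[s0 s1].
have [->|sN0] := eqVneq s 0; first by rewrite scale0r add0r subr0 scale1r.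
have [->|sN1] := eqVneq s 1; first by rewrite subrr scale0r addr0 scale1r.
by apply: strict_mix => //; [exact: subset_closure | rewrite !lt_neqAle eq_sym sN0 sN1 s0 s1].
Qed.

Lemma open_inball x : D x -> exists2 r : R, 0 < r & inball D x r.
Proof. by move=> Dx; apply/nbhs_rnormP; exact: open_nbhs_nbhs. Qed.

Lemma inball_center x r : 0 < r -> inball D x r -> D x.
Proof. by move=> r0; apply; rewrite subrr rnorm0. Qed.

(** A displacement of the combination is absorbed by [y] alone, where it is divided by [1 - s]. *)
Lemma inball_mix x y r s : closure D x -> inball D y r -> 0 < r -> 0 < s < 1 ->
  inball D (s%:C *: x + (1 - s)%:C *: y) ((1 - s) * r).
Proof.
move=> Dx by_ r0 /andP[s0 s1] v hv.
have t0 : 0 < 1 - s by rewrite subr_gt0.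
have tN0 : (1 - s)%:C != 0 :> R[i] by apply/eqP; case=> e; move: t0; rewrite e ltxx.
set w := s%:C *: x + _ in hv.
have -> : v = s%:C *: x + (1 - s)%:C *: (y + (1 - s)%:C^-1 *: (v - w)).
  by rewrite scalerDr scalerA mulfV // scale1r addrA -/w subrKC.
apply: strict_mix => //; last by rewrite s0.
apply: by_; rewrite [y + _]addrC addrK (@rnormZ _ V ((1 - s)%:C^-1 : R[i]^o)).
by rewrite rnormV rnormC_ge0 ?(ltW t0) // mulrC ltr_pdivrMr // mulrC.
Qed.

(** The coefficient of [phi 0] in [harnack]: one chain step costs an inscribed ball at most this
    factor of its radius. *)
Definition harnack_const (c : R) : R := ((1 - c) / (1 + c)) ^+ 2.

Lemma near_ball (c : R) x y r : 0 < c < 1 -> 0 < r -> inball D x r -> near D c x y ->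
  inball D y (harnack_const c * r).
Proof.
move=> /andP[c0 c1] r0 bx [c' /andP[c'0 c'c] [[phi [dphi Dphi phi0 phic]] _]].
have c'1 : c' < 1 := lt_trans c'c c1.
have [|y0 Dy0] := harnack strictly_convex_cvx _ dphi Dphi (c := c'); first by rewrite c'0.
rewrite /= phic phi0 => ->.
have d0 : 0 < (1 - c') / (1 + c') by rewrite divr_gt0 ?subr_gt0 // addr_gt0.
have e0 : 0 < (1 - c) / (1 + c) by rewrite divr_gt0 ?subr_gt0 // addr_gt0.
have de : (1 - c) / (1 + c) <= (1 - c') / (1 + c').
  by rewrite ler_pdivrMr ?addr_gt0 // mulrAC ler_pdivlMr ?addr_gt0 //; lra.
set b := ((1 - c') / (1 + c')) ^+ 2.
have b0 : 0 < b by rewrite exprn_gt0.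
have b1 : b < 1.
  rewrite expr_lt1 // ?ltW // ltr_pdivrMr ?addr_gt0 // mul1r; lra.
have hb : harnack_const c <= b by rewrite /harnack_const /b ler_pXn2r ?nnegrE // ltW.
have {2}-> : b = 1 - (1 - b) by ring.
move=> v hv; apply: (inball_mix Dy0 bx r0 (s := 1 - b)).
  by apply/andP; split; lra.
apply: lt_le_trans hv _; rewrite subKr ler_wpM2r // ltW //.
Qed.

Variable c : R.
Hypothesis c01 : 0 < c < 1.

Fixpoint link n x y : Prop :=
  if n is n'.+1 then exists v, [/\ D v, near D c x v & link n' v y] else x = y.

Lemma link1 x y : D y -> near D c x y -> link 1 x y.
Proof. by move=> Dy h; exists y. Qed.

Lemma link_refl n x : D x -> link n x x.
Proof.
move=> Dx; elim: n => [|n IH] //=; exists x; split=> //; apply: near_refl => //.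
by case/andP: c01.
Qed.

Lemma link_cat n m x y v : link n x y -> link m y v -> link (n + m) x v.
Proof.
elim: n x => [|n IH] x /= => [->|] // [u [Du xu uy]] yv.
by exists u; split=> //; exact: IH.
Qed.

Lemma link_sym n x y : D x -> link n x y -> link n y x.
Proof.
elim: n x => [|n IH] x Dx /= => [->|] // [u [Du xu /(IH _ Du) uy]].
by have := link_cat uy (link1 Dx (near_sym xu)); rewrite addn1.
Qed.

Lemma link_in n x y : D x -> link n x y -> D y.
Proof. by elim: n x => [|n IH] x Dx /= => [<-|[u [Du _ /(IH _ Du)]]]. Qed.

(** Constant steps pad a chain, so the length acts as an upper bound for a distance. *)
Lemma link_mono n m x y : D x -> (n <= m)%N -> link n x y -> link m x y.
Proof.
move=> Dx /subnK <- h; apply: link_cat h; exact: link_refl.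
Qed.

Lemma link_map (T : V -> V) n x y : set_fun D D T -> nonexpansive D T ->
  D x -> link n x y -> link n (T x) (T y).
Proof.
move=> TD nT; elim: n x => [|n IH] x Dx /= => [->|] // [u [Du xu uy]].
exists (T u); split; [exact: TD | | exact: IH].
move: xu; rewrite !nearP // => -[h1 h2].
by split; [exact: le_lt_trans (nT _ _ Dx Du) h1 | exact: le_lt_trans (nT _ _ Du Dx) h2].
Qed.

Lemma link_cvx n s x y u v : 0 <= s <= 1 -> link n x y -> link n u v ->
  link n (s%:C *: x + (1 - s)%:C *: u) (s%:C *: y + (1 - s)%:C *: v).
Proof.
move=> hs; have cD := strictly_convex_cvx.
elim: n x u => [|n IH] x u /= => [-> ->|] //.
move=> [a [Da xa ay]] [b [Db ub bv]].
exists (s%:C *: a + (1 - s)%:C *: b); split; [exact: cD | exact: near_cvx | exact: IH].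
Qed.

(** Cutting chains takes the place of choosing points on geodesics. *)
Lemma link_split n m x y : link (n + m) x y -> exists2 v, link n x v & link m v y.
Proof.
elim: n x => [|n IH] x /=; first by exists x.
by move=> [u [Du xu /IH[v uv vy]]]; exists v => //; exists u.
Qed.

Lemma link_ball n x y r : 0 < r -> inball D x r -> link n x y ->
  inball D y (harnack_const c ^+ n * r).
Proof.
have b0 : 0 < harnack_const c.
  by case/andP: c01 => c0 c1; rewrite exprn_gt0 // divr_gt0 ?subr_gt0 // addr_gt0.
move=> r0; elim: n x r r0 => [|n IH] x r r0 bx /=; first by move=> <-; rewrite expr0 mul1r.
move=> [u [Du xu uy]]; rewrite exprSr -mulrA; apply: IH uy; first exact: mulr_gt0.
exact: near_ball xu.
Qed.

(** By convexity all points of the segment are centres of balls of one radius [r] in [D]; the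
    segment is cut into pieces shorter than [r * c]. *)
Lemma link_exists x y : D x -> D y -> exists n, link n x y.
Proof.
have [c0 c1] := andP c01 => Dx Dy.
have [r1 r10 b1] := open_inball Dx; have [r2 r20 b2] := open_inball Dy.
pose r := Num.min r1 r2.
have r0 : 0 < r by rewrite lt_min r10.
have bx : inball D x r by move=> v hv; apply: b1; apply: lt_le_trans hv _; rewrite ge_min lexx.
have by_ : inball D y r.
  by move=> v hv; apply: b2; apply: lt_le_trans hv _; rewrite ge_min lexx orbT.
have cD := strictly_convex_cvx.
have bmix s : 0 <= s <= 1 -> inball D (s%:C *: y + (1 - s)%:C *: x) r.
  move=> hs v; set w := s%:C *: y + _ => hv.
  have -> : v = s%:C *: (y + (v - w)) + (1 - s)%:C *: (x + (v - w)).
    by rewrite !(scalerDr _ _ (v - w)) addrACA comb_self -/w subrKC.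
  by apply: cD => //; [apply: by_ | apply: bx]; rewrite [_ + (v - w)]addrC addrK.
have rc : 0 < r * c by rewrite mulr_gt0.
pose m := (Num.truncn (rnorm (y - x) / (r * c))).+1.
have hm : rnorm (y - x) / m%:R < r * c.
  have : rnorm (y - x) / (r * c) < m%:R by rewrite truncnS_gt.
  by rewrite !ltr_pdivrMr // mulrC.
pose p k := ((k%:R / m%:R)%:C *: y + (1 - k%:R / m%:R)%:C *: x : V).
have inp k : (k <= m)%N -> inball D (p k) r.
  by move=> km; apply: bmix; rewrite divr_ge0 //= ler_pdivrMr ?ltr0n // mul1r ler_nat.
have lk k : (k <= m)%N -> link k x (p k).
  elim: k => [|k IH] km.
    by rewrite /= /p mul0r scale0r add0r subr0 scale1r.
  suff nk : near D c (p k) (p k.+1).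
    by have := link_cat (IH (ltnW km)) (link1 (inball_center r0 (inp _ km)) nk); rewrite addn1.
  apply: (near_small c0 r0 (inp _ (ltnW km)) (inp _ km)).
  have -> : p k.+1 - p k = (m%:R^-1)%:C *: (y - x).
    have e1 : k.+1%:R / m%:R = k%:R / m%:R + m%:R^-1 :> R.
      by rewrite -natr1 mulrDl mul1r.
    have e2 : 1 - (k%:R / m%:R + m%:R^-1) = (1 - k%:R / m%:R) - m%:R^-1 :> R.
      by rewrite opprD addrA.
    rewrite {1}/p e1 e2 [(_ + _)%:C]rmorphD [((1 - _) - _)%:C]rmorphB /= scalerDl (scalerBl _ _ x).
    by rewrite [X in X - _]addrACA -/(p k) [X in X - _]addrC addrK scalerBr.
  rewrite rnormZ rnormC_ge0 ?invr_ge0 ?ler0n // mulrC.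
  exact: hm.
exists m; have := lk m (leqnn m).
by rewrite /p divff ?pnatr_eq0 // scale1r subrr scale0r addr0.
Qed.

Lemma link_near_point q : D q -> exists2 r : R, 0 < r &
  forall u, rnorm (u - q) < r -> [/\ D u, link 1 q u & link 1 u q].
Proof.
have [c0 c1] := andP c01 => Dq; have [r r0 bq] := open_inball Dq.
have r20 : 0 < r / 2 by rewrite divr_gt0.
exists (r / 2 * c); first by rewrite mulr_gt0.
move=> u uq.
have ur : rnorm (u - q) < r / 2 by apply: lt_le_trans uq _; rewrite ler_piMr // ltW.
have Du : D u by apply: bq; apply: lt_trans ur _; lra.
have bu : inball D u (r / 2).
  by move=> v vu; apply: bq; apply: le_lt_trans (rnorm_tri _ u _) _; lra.
have bq2 : inball D q (r / 2) by move=> v vq; apply: bq; lra.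
have h : near D c q u by apply: near_small bq2 bu uq.
by split=> //; apply: link1 => //; exact: near_sym.
Qed.

Lemma harnack_const_gt0 : 0 < harnack_const c.
Proof.
by case/andP: c01 => c0 c1; rewrite exprn_gt0 // divr_gt0 ?subr_gt0 // addr_gt0.
Qed.

(* If [y] clustered at [eta <> xi], the midpoint of [x] and [y], which is joined to
   [x] by a chain of length [n], would stay well inside [D]; by Harnack's inequality
   so would [x]. *)
Lemma boundary_stable (K : set V) xi n : compact K -> closure D xi -> ~ D xi ->
  forall e : R, 0 < e -> exists2 d : R, 0 < d &
    forall x y, D x -> D y -> K y -> rnorm (x - xi) < d -> link n x y -> rnorm (y - xi) < e.
Proof.
move=> cK cxi nxi e e0; apply: contrapT => H.
have /choice[g hg] : forall k : nat, exists p : V * V,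
    [/\ D p.1, D p.2, K p.2, rnorm (p.1 - xi) < k.+1%:R^-1 & link n p.1 p.2 /\ e <= rnorm (p.2 - xi)].
  move=> k; apply: contrapT => H'; apply: H; exists k.+1%:R^-1; first by rewrite invr_gt0.
  move=> x y Dx Dy Ky xxi lxy; rewrite ltNge; apply/negP => ey.
  by apply: H'; exists (x, y).
have [eta Keta cl] : exists2 q, K q & forall (e : R) N, 0 < e ->
    exists2 k, (N <= k)%N & rnorm ((g k).2 - q) < e.
  by apply: (compact_cluster cK) => k; case: (hg k).
have ceta : closure D eta.
  apply/closure_rnormP => e' e'0; have [k _ hk] := cl e' 0%N e'0.
  by exists (g k).2 => //; case: (hg k).
have xieta : xi <> eta.
  move=> E; have [k _ hk] := cl e 0%N e0; have [_ _ _ _ [_]] := hg k.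
  by rewrite E leNgt hk.
have h01 : 0 < (2^-1 : R) < 1 by rewrite invr_gt0 ltr0n invf_lt1 // ltr1n.
have [r r0 bm] := open_inball (scD cxi ceta xieta h01).
set m := _ + _ in bm.
have b0 := harnack_const_gt0.
(* The first bound keeps [mk] within [r / 2] of [m]; the second puts [xi] into the ball about [x]
   that [link_ball] provides. *)
pose d := Num.min (r / 2) (harnack_const c ^+ n * (r / 2)).
have r20 : 0 < r / 2 by rewrite divr_gt0.
have d0 : 0 < d by rewrite lt_min r20 mulr_gt0 // exprn_gt0.
have [k Nk hk] := cl (r / 2) (Num.truncn d^-1) (divr_gt0 r0 (ltr0Sn _ 1)).
have [Dx Dy Ky xxi [lxy _]] := hg k.
move: (g k) Dx Dy Ky xxi lxy hk => [x y] /= Dx Dy Ky xxi lxy hk.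
have xd : rnorm (x - xi) < d.
  apply: lt_trans xxi _; rewrite -[d]invrK ltf_pV2 ?posrE ?invr_gt0 //.
  by apply: lt_le_trans (truncnS_gt _) _; rewrite ler_nat ltnS.
move: (xd); rewrite lt_min => /andP[x1 x2].
pose mk : V := 2^-1%:C *: x + (1 - 2^-1)%:C *: y.
have mkm : rnorm (mk - m) < r / 2.
  have -> : mk - m = (2^-1)%:C *: (x - xi) + (1 - 2^-1)%:C *: (y - eta).
    by rewrite /mk /m opprD addrACA !scalerBr.
  have h2 : 1 - 2^-1 = 2^-1 :> R by field.
  rewrite h2; apply: le_lt_trans (rnormD _ _) _.
  by rewrite !(@rnormZ _ V ((2^-1)%:C : R[i]^o)) rnormC_ge0 ?invr_ge0 ?ler0n //; lra.
have bmk : inball D mk (r / 2).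
  by move=> v hv; apply: bm; apply: le_lt_trans (rnorm_tri _ mk _) _; lra.
have Dmk : D mk by apply: inball_center bmk; rewrite divr_gt0.
have lk : link n x mk.
  have h012 : 0 <= (2^-1 : R) <= 1 by rewrite invr_ge0 ler0n invf_le1 // ler1n.
  by have := link_cvx h012 (link_refl n Dx) lxy; rewrite comb_self.
apply: nxi; apply: (link_ball (divr_gt0 r0 (ltr0Sn _ 1)) bmk (link_sym Dx lk)).
by rewrite rnormB.
Qed.

End Links.

(** * Fixed points of averaged maps *)

Lemma geometric_cvg (R : realType) (V : completeNormedModType R[i]) (u : nat -> V) (A k : R) :
  0 <= A -> 0 < k < 1 -> (forall n, rnorm (u n.+1 - u n) <= A * k ^+ n) ->
  exists l, forall e : R, 0 < e -> exists N, forall n, (N <= n)%N -> rnorm (u n - l) < e.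
Proof.
move=> A0 /andP[k0 k1] hu.
have d0 : 0 < 1 - k by rewrite subr_gt0.
have kp n : 0 <= k ^+ n by rewrite exprn_ge0 // ltW.
have tail n m : rnorm (u (n + m)%N - u n) <= A * k ^+ n * (1 - k ^+ m) / (1 - k).
  elim: m => [|m IH]; first by rewrite addn0 subrr rnorm0 expr0 subrr mulr0 mul0r.
  rewrite addnS; apply: le_trans (rnorm_tri _ (u (n + m)%N) _) _.
  have -> : A * k ^+ n * (1 - k ^+ m.+1) / (1 - k) =
      A * k ^+ (n + m) + A * k ^+ n * (1 - k ^+ m) / (1 - k).
    by rewrite exprD exprS; field; rewrite gt_eqF.
  exact: lerD (hu _) IH.
have small e : 0 < e -> exists N, forall n, (N <= n)%N -> rnorm (u n - u N) < e.
  move=> e0.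
  have e1 : 0 < e * (1 - k) / (A + 1) by rewrite divr_gt0 ?mulr_gt0 // ltr_wpDl.
  have nk1 : `|k| < 1 by rewrite ger0_norm // ltW.
  have [N _ hN] : \forall n \near \oo, `|0 - k ^+ n| < e * (1 - k) / (A + 1).
    by have /cvgrPdist_lt := cvg_expr nk1; apply.
  exists N => n /subnKC <-; apply: le_lt_trans (tail _ _) _.
  have := hN N (leqnn N); rewrite /= sub0r normrN ger0_norm // => hk.
  rewrite ltr_pdivrMr //; apply: le_lt_trans (_ : A * k ^+ N < _).
    by rewrite ler_piMr ?mulr_ge0 // lerBlDr lerDl.
  apply: le_lt_trans (_ : (A + 1) * k ^+ N < _); first by rewrite ler_wpM2r // lerDl.
  by rewrite mulrC -ltr_pdivlMr // ltr_wpDl.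
have /cauchy_cvg/cvg_ex[l hl] : cauchy (u @ \oo).
  apply: cauchy_exP => e; rewrite ltcE /= => /andP[/eqP ei er].
  have [N hN] := small _ er; exists (u N); exists N => // n /hN.
  rewrite /= -ball_normE /ball_ /= distrC normE ltcE /= => ->.
  by rewrite ei eqxx.
exists l => e e0; have : nbhs l [set y | rnorm (y - l) < e] by apply/nbhs_rnormP; exists e.
by move=> /hl[N _ hN]; exists N => n /hN.
Qed.

Section Averaged.
Variables (R : realType) (V : completeNormedModType R[i]) (D : set V) (M : R) (T : V -> V).
Hypotheses (oD : open D) (scD : strictly_convex D) (bD : forall v, D v -> rnorm v <= M).
Hypotheses (TD : set_fun D D T) (nT : nonexpansive D T).
Implicit Types (x y p : V) (s c r : R) (n : nat).

Lemma near_map c x y : 0 < c < 1 -> D x -> D y -> near D c x y -> near D c (T x) (T y).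
Proof.
move=> c01 Dx Dy; rewrite !nearP // => -[h1 h2].
by split; [exact: le_lt_trans (nT Dx Dy) h1 | exact: le_lt_trans (nT Dy Dx) h2].
Qed.

(** [near_small] turns closeness in norm into a short step, which [T] preserves, and [near_norm]
    turns it back. *)
Lemma nonexpansive_continuous q : D q -> forall e : R, 0 < e ->
  exists2 d : R, 0 < d & forall u, rnorm (u - q) < d -> D u /\ rnorm (T u - T q) < e.
Proof.
move=> Dq e e0; have [r r0 bq] := open_inball oD Dq.
have M0 : 0 <= M := le_trans (rnorm_ge0 _) (bD Dq).
pose c := Num.min 2^-1 (e / (2 * M + 1)).
have M1 : 0 < 2 * M + 1 by rewrite ltr_wpDl // mulr_ge0.
have c0 : 0 < c by rewrite lt_min invr_gt0 ltr0n /= divr_gt0.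
have c2 : c <= 2^-1 by rewrite ge_min lexx.
have c01 : 0 < c < 1 by rewrite c0 /=; lra.
have cM : 2 * M * c < e.
  apply: (@lt_le_trans _ _ ((2 * M + 1) * c)); first by rewrite ltr_pM2r // ltrDl.
  by rewrite mulrC -ler_pdivlMr // ge_min lexx orbT.
have r20 : 0 < r / 2 by rewrite divr_gt0.
exists (r / 2 * c); first by rewrite mulr_gt0.
move=> u uq.
have ur : rnorm (u - q) < r / 2 by apply: lt_le_trans uq _; rewrite ler_piMr ?ltW //; lra.
have Du : D u by apply: bq; lra.
split=> //.
have bu : inball D u (r / 2).
  by move=> v vu; apply: bq; apply: le_lt_trans (rnorm_tri _ u _) _; lra.
have bq2 : inball D q (r / 2) by move=> v vq; apply: bq; lra.
have h : near D c q u by apply: near_small bq2 bu uq.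
by apply: le_lt_trans (near_norm bD _ (near_map c01 Dq Du h)) cM; lra.
Qed.

Definition averaged s p x : V := s%:C *: T x + (1 - s)%:C *: p.

Lemma averaged_in s p x : 0 < s < 1 -> D p -> D x -> D (averaged s p x).
Proof. by move=> hs Dp Dx; apply: strict_mix => //; apply/subset_closure/TD. Qed.

(* A disc in [s *: D + (1 - s) *: p] may be perturbed by vectors of size
   [(1 - s) * r]; such a perturbation moves the second point to a smaller
   parameter. *)
Lemma adisc_contract s p r : 0 < s < 1 -> 0 < r -> inball D p r ->
  exists2 k : R, 0 < k < 1 & forall c x y, 0 < c <= 2^-1 -> adisc D c x y ->
    adisc D (k * c) (s%:C *: x + (1 - s)%:C *: p) (s%:C *: y + (1 - s)%:C *: p).
Proof.
move=> hs r0 bp; have /andP[s0 s1] := hs; have Dp := inball_center r0 bp.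
have M0 : 0 <= M := le_trans (rnorm_ge0 _) (bD Dp).
have t0 : 0 < 1 - s by rewrite subr_gt0.
(* The perturbation will have size at most [4 * M * eta], which is thereby below the slack
   [(1 - s) * r] of [inball_mix]. *)
pose eta := (1 - s) * r / (4 * M + 1).
have M1 : 0 < 4 * M + 1 by rewrite ltr_wpDl // mulr_ge0.
have eta0 : 0 < eta by rewrite divr_gt0 // mulr_gt0.
have eta1 : 0 < 1 + eta by rewrite addr_gt0.
have k1 : (1 + eta)^-1 < 1 by rewrite invf_lt1 // ltrDl.
exists (1 + eta)^-1; first by rewrite invr_gt0 eta1.
move=> c x y /andP[c0 c2] [phi [dphi Dphi <- <-]].
set c' := (1 + eta)^-1 * c.
have c'0 : 0 < c' by rewrite mulr_gt0 // invr_gt0.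
have cE : c = c' + eta * c' by rewrite /c'; field; rewrite gt_eqF.
have c'c : c' <= c by rewrite cE lerDl mulr_ge0 // ltW.
pose d := phi c%:C - phi c'%:C.
have dle : rnorm d <= 4 * M * (eta * c').
  (* Schwarz's lemma is used about [c'] on the disc of radius 1/2, which lies in the closed unit
     disc because [c' <= 2^-1]. *)
  pose psi (z : R[i]^o) := phi (c'%:C + 1 * z).
  have in1 (z : R[i]^o) : rnorm z <= 2^-1 -> rnorm (c'%:C + 1 * z : R[i]^o) <= 1.
    move=> z2; apply: le_trans (rnormD _ _) _; rewrite mul1r rnormC_ge0 ?(ltW c'0) //; lra.
  have h0 : 0 < (2^-1 : R) by rewrite invr_gt0.
  have dpsi z : rnorm z <= 2^-1 -> derivable psi z 1.
    by move=> z2; apply: derivable_comp; [exact: derivable_lin | exact/dphi/in1].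
  have bpsi z : rnorm z <= 2^-1 -> rnorm (psi z) <= M.
    by move=> z2; exact/bD/Dphi/in1.
  have ec0 : 0 <= eta * c' by rewrite mulr_ge0 // ltW.
  have := schwarz h0 dpsi bpsi (z := (eta * c')%:C).
  rewrite rnormC_ge0 // /psi mul1r mulr0 addr0 -rmorphD /= -cE invrK.
  have -> : 2 * M * 2 = 4 * M by ring.
  by apply; move: c2; rewrite cE; lra.
have c'N0 : c'%:C != 0 :> R[i] by apply/eqP; case=> e; move: c'0; rewrite e ltxx.
exists (fun z => (s%:C *: phi z + (1 - s)%:C *: p) + (0 + (s%:C / c'%:C) * z : R[i]^o) *: d); split.
move=> z z1; apply: derivableD.
    by apply: derivableD; [apply: derivable_scalel; exact: dphi | exact: derivable_cst].
  by apply: derivable_scaler; exact: derivable_lin.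
move=> z z1; apply: (inball_mix scD (subset_closure (Dphi z z1)) bp r0 hs).
  rewrite [_ + _ *: d]addrC addrK (@rnormZ _ V (_ : R[i]^o)) add0r !rnormM rnormV.
  rewrite !rnormC_ge0 ?(ltW c'0) ?(ltW s0) //.
  apply: (@le_lt_trans _ _ (1 / c' * 1 * (4 * M * (eta * c')))).
    have i0 : 0 <= c'^-1 by rewrite invr_ge0 ltW.
    have f0 : 0 <= s / c' by rewrite mulr_ge0 // ltW.
    have f1 : s / c' <= 1 / c' by rewrite ler_wpM2r // ltW.
    exact: (ler_pM (mulr_ge0 f0 (rnorm_ge0 z)) (rnorm_ge0 d)
      (ler_pM f0 (rnorm_ge0 z) f1 z1) dle).
  have -> : 1 / c' * 1 * (4 * M * (eta * c')) = 4 * M * eta by field; rewrite gt_eqF.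
  rewrite /eta mulrA ltr_pdivrMr // mulrC ltr_pM2l ?mulr_gt0 //; lra.
by rewrite mulr0 addr0 scale0r addr0.
rewrite add0r divfK // -addrA addrC addrAC -addrA -scalerDr.
  by rewrite /d subrKC addrC.
Qed.

Lemma near_contract s p : 0 < s < 1 -> D p ->
  exists2 k : R, 0 < k < 1 & forall c x y, 0 < c <= 2^-1 -> D x -> D y -> near D c x y ->
    near D (k * c) (averaged s p x) (averaged s p y).
Proof.
move=> hs Dp; have [r r0 bp] := open_inball oD Dp.
have [k hk h] := adisc_contract hs r0 bp; exists k => // c x y /andP[c0 c2] Dx Dy hxy.
have c01 : 0 < c < 1 by rewrite c0 /=; lra.
have [c' /andP[c'0 c'c] [h1 h2]] := near_map c01 Dx Dy hxy.
have /andP[k0 k1] := hk.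
exists (k * c'); first by rewrite mulr_gt0 //= ltr_pM2l.
by split; apply: h => //; rewrite c'0 /=; lra.
Qed.

(** Contraction principle: the chain from an iterate to the next keeps its length [m] while its step
    size decays geometrically. The limit is in [D] since it mixes [p] with the limit [t] of the
    images under [T], a point of the closure. *)
Lemma averaged_fixpoint s p : 0 < s < 1 -> D p ->
  exists q, [/\ D q, q = averaged s p q &
    forall e : R, 0 < e -> exists n, rnorm (iter n (averaged s p) p - q) < e].
Proof.
move=> hs Dp; have /andP[s0 s1] := hs; set f := averaged s p.
have fD x : D x -> D (f x) by exact: averaged_in.
have [k /andP[k0 k1] hk] := near_contract hs Dp.
have c01 : 0 < (2^-1 : R) < 1 by rewrite invr_gt0 ltr0n invf_lt1 // ltr1n.
have fnD n : D (iter n f p) by elim: n => [|n IH] //=; exact: fD.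
have [m hm] := link_exists oD scD c01 Dp (fD _ Dp).
have link_f c x y : 0 < c <= 2^-1 -> forall n, D x -> link D c n x y -> link D (k * c) n (f x) (f y).
  move=> hc n; elim: n x => [|n IH] x Dx /= => [->|] // [u [Du xu uy]].
  by exists (f u); split; [exact: fD | exact: hk | exact: IH].
have link_n n : link D (2^-1 * k ^+ n) m (iter n f p) (iter n.+1 f p).
  elim: n => [|n IH]; first by rewrite expr0 mulr1.
  have -> : 2^-1 * k ^+ n.+1 = k * (2^-1 * k ^+ n) by rewrite exprS; ring.
  apply: (link_f _ _ _ _ m (fnD n) IH); apply/andP; split.
    by rewrite mulr_gt0 ?exprn_gt0 // invr_gt0.
  by rewrite ler_piMr ?invr_ge0 // exprn_ile1 // ltW.
have M0 : 0 <= M := le_trans (rnorm_ge0 _) (bD Dp).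
have norm_link c n x y : c <= 1 -> link D c n x y -> rnorm (y - x) <= n%:R * (2 * M * c).
  move=> c1; elim: n x => [|n IH] x /= => [->|[u [Du xu /IH uy]]].
    by rewrite subrr rnorm0 mul0r.
  apply: le_trans (rnorm_tri _ u _) _; rewrite -natr1 mulrDl mul1r.
  exact: lerD uy (near_norm bD c1 xu).
have [q hq] : exists l, forall e : R, 0 < e -> exists N, forall n, (N <= n)%N ->
    rnorm (iter n f p - l) < e.
  apply: (@geometric_cvg _ _ _ (m%:R * M) k); rewrite ?mulr_ge0 ?k0 //= => n.
  have kn : k ^+ n <= 1 by rewrite exprn_ile1 // ltW.
  apply: le_trans (norm_link _ _ _ _ _ (link_n n)) _; first by lra.
  have -> // : m%:R * (2 * M * (2^-1 * k ^+ n)) = m%:R * M * k ^+ n by field.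
have sN0 : s%:C != 0 :> R[i] by apply/eqP; case=> e; move: s0; rewrite e ltxx.
pose t := s%:C^-1 *: (q - (1 - s)%:C *: p).
have qt : q = s%:C *: t + (1 - s)%:C *: p by rewrite /t scalerA mulfV // scale1r subrK.
have Tt n : T (iter n f p) - t = s%:C^-1 *: (iter n.+1 f p - q).
  rewrite [in RHS]qt iterS {1}/f /averaged opprD addrACA subrr addr0 -scalerBr.
  by rewrite scalerA mulVf // scale1r.
have Tt_small e : 0 < e -> exists N, forall n, (N <= n)%N -> rnorm (T (iter n f p) - t) < e.
  move=> e0; have [N hN] := hq (e * s) (mulr_gt0 e0 s0); exists N => n Nn.
  rewrite Tt (@rnormZ _ V (s%:C^-1 : R[i]^o)) rnormV rnormC_ge0 ?(ltW s0) //.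
  by rewrite mulrC ltr_pdivrMr //; apply: hN; exact: leqW.
have ct : closure D t.
  apply/closure_rnormP => e e0; have [N hN] := Tt_small e e0.
  by exists (T (iter N f p)); [exact/TD | exact: hN].
have Dq : D q by rewrite qt; exact: strict_mix.
have tT : t = T q.
  apply/eqP; rewrite -subr_eq0; apply/eqP/rnorm_eq0/eqP.
  rewrite eq_le rnorm_ge0 andbT; apply/ler_addgt0Pr => e e0; rewrite add0r.
  have e20 : 0 < e / 2 by rewrite divr_gt0.
  have [N1 h1] := Tt_small _ e20.
  have [d d0 hd] := nonexpansive_continuous Dq e20; have [N2 h2] := hq d d0.
  pose n := maxn N1 N2.
  have := h1 n (leq_maxl _ _); have [_] := hd _ (h2 n (leq_maxr _ _)) => a1 a2.
  apply: le_trans (rnorm_tri _ (T (iter n f p)) _) _.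
  by rewrite (rnormB t); lra.
exists q; split=> //; first by rewrite /f /averaged -tT.
by move=> e /hq[N hN]; exists N; exact: hN.
Qed.
End Averaged.

(** * Orbits *)

Section Orbits.
Variables (R : realType) (V : completeNormedModType R[i]) (D K : set V) (M c : R) (T : V -> V).
Hypotheses (oD : open D) (scD : strictly_convex D) (bD : forall v, D v -> rnorm v <= M).
Hypotheses (TD : set_fun D D T) (nT : nonexpansive D T).
Hypotheses (cK : compact K) (TK : forall x, D x -> K (T x)) (c01 : 0 < c < 1).
Implicit Types (x y u v q : V) (n m k : nat).

Local Notation link := (link D c).

Lemma iter_in n x : D x -> D (iter n T x).
Proof. by move=> Dx; elim: n => [|n IH] //=; exact: TD. Qed.

Lemma iter_compact n x : (0 < n)%N -> D x -> K (iter n T x).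
Proof. by case: n => [//|n] _ Dx; apply/TK/iter_in. Qed.

Lemma link_iter k n x y : D x -> link n x y -> link n (iter k T x) (iter k T y).
Proof.
move=> Dx xy; elim: k => [|k IH] //=; apply: link_map => //; exact: iter_in.
Qed.

(* The points eventually at distance at most [B] from the orbit form a convex
   invariant set, which contains the iterates of the averaged maps. *)
Lemma bounded_orbit_fixpoint x B : D x -> (forall n, link B x (iter n T x)) ->
  exists2 q, D q & T q = q.
Proof.
move=> Dx hB.
have [r0 r00 bx] := open_inball oD Dx.
pose C u := D u /\ exists N, forall n, (N <= n)%N -> link B u (iter n T x).
have TC u : C u -> C (T u).
  move=> [Du [N hN]]; split; first exact: TD.
  by exists N.+1 => -[//|n] Nn; apply: link_map => //; exact: hN.
have Cx : C x by split=> //; exists 0%N => n _; exact: hB.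
have cC u v (s : R) : 0 < s < 1 -> C u -> C v -> C (s%:C *: u + (1 - s)%:C *: v).
  move=> /andP[s0 s1] [Du [N1 h1]] [Dv [N2 h2]].
  have hs : 0 <= s <= 1 by rewrite !ltW.
  split; first exact: strictly_convex_cvx.
  exists (maxn N1 N2) => n; rewrite geq_max => /andP[n1 n2].
  by have := link_cvx scD hs (h1 n n1) (h2 n n2); rewrite comb_self.
pose s k : R := 1 - k.+2%:R^-1.
have s01 k : 0 < s k < 1.
  by rewrite /s subr_gt0 invf_lt1 ?ltr0n // ltr1n /= ltrBlDr ltrDl invr_gt0 ltr0n.
(* The exponent counts [B] steps from [x] to a late orbit point, [B] back to an iterate of the
   averaged map, and one to its fixed point. *)
pose rho := harnack_const c ^+ (B + B + 1) * r0.
have b0 := harnack_const_gt0 c01.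
have rho0 : 0 < rho by rewrite mulr_gt0 // exprn_gt0.
have /choice[y hy] : forall k, exists q, [/\ D q, q = averaged T (s k) x q & inball D q rho].
  move=> k; have [q [Dq qE qlim]] := averaged_fixpoint oD scD bD TD nT (s01 k) Dx.
  exists q; split=> //.
  have Cn n : C (iter n (averaged T (s k) x) x).
    by elim: n => [|n IH] //=; apply: cC => //; exact: TC.
  have [r r1 hr] := link_near_point oD c01 Dq.
  have [n hn] := qlim r r1; have [Du [N hN]] := Cn n.
  have [_ _ uq] := hr _ hn.
  apply: (link_ball scD c01 r00 bx); apply: link_cat uq; apply: link_cat (hB N) _.
  by apply: link_sym => //; exact: hN.
have [q Kq cl] : exists2 q, K q & forall (e : R) N, 0 < e ->
    exists2 k, (N <= k)%N & rnorm (T (y k) - q) < e.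
  by apply: (compact_cluster cK) => k; apply: TK; case: (hy k).
have M0 : 0 <= M := le_trans (rnorm_ge0 _) (bD Dx).
have yT k : rnorm (y k - T (y k)) <= (2 * M) / k.+2%:R.
  have [Dy yE _] := hy k.
  have -> : y k - T (y k) = (k.+2%:R^-1)%:C *: (x - T (y k)).
    rewrite {1}yE /averaged /s subKr scalerBr addrC rmorphB scalerBl scale1r.
    by rewrite -addrA addKr addrC.
  rewrite (@rnormZ _ V (_%:C : R[i]^o)) rnormC_ge0 ?invr_ge0 // mulrC.
  rewrite ler_wpM2r ?invr_ge0 //; apply: le_trans (rnormD _ _) _; rewrite rnormN.
  by rewrite mulr_natl mulr2n lerD //; apply: bD => //; exact: TD.
have small e : 0 < e -> exists k, rnorm (y k - q) < e /\ rnorm (T (y k) - q) < e.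
  move=> e0; have e20 : 0 < e / 2 by rewrite divr_gt0.
  have [k Nk hk] := cl _ (Num.truncn (2 * M / (e / 2))) e20.
  exists k; split; last by lra.
  apply: le_lt_trans (rnorm_tri _ (T (y k)) _) _.
  have : 2 * M / k.+2%:R < e / 2.
    have : 2 * M / (e / 2) < k.+2%:R.
      by apply: lt_le_trans (truncnS_gt _) _; rewrite ler_nat ltnS; exact: leqW.
    by rewrite !ltr_pdivrMr ?ltr0n // [_ * (e / 2)]mulrC.
  by move=> h; have := le_lt_trans (yT k) h; lra.
(* The radius [rho] is the same for all [k], so the cluster point cannot lie outside [D]. *)
have Dq : D q.
  have [k [h _]] := small rho rho0; have [_ _] := hy k; apply.
  by rewrite rnormB.
exists q => //; apply/eqP; rewrite -subr_eq0; apply/eqP/rnorm_eq0/eqP.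
rewrite eq_le rnorm_ge0 andbT; apply/ler_addgt0Pr => e e0; rewrite add0r.
have e20 : 0 < e / 2 by rewrite divr_gt0.
have [d d0 hd] := nonexpansive_continuous oD bD nT Dq e20.
have : 0 < Num.min d (e / 2) by rewrite lt_min d0.
move=> /small[k []]; rewrite !lt_min => /andP[y1 _] /andP[_ y2].
have [_ h] := hd _ y1.
by apply: le_trans (rnorm_tri _ (T (y k)) _) _; rewrite (rnormB (T q)); lra.
Qed.

(* Calka's argument. The orbit points close to a cluster point [eta] form a
   precompact set, so finitely many of them control all; hence the return times
   to a neighbourhood of [eta] have bounded gaps. *)
Lemma recurrent_orbit_bounded x M0 : D x ->
  (forall N, exists2 n, (N <= n)%N & link M0 x (iter n T x)) ->
  exists B, forall n, link B x (iter n T x).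
Proof.
move=> Dx hrec; have [c0 c1] := andP c01.
have [r0 r00 bx] := open_inball oD Dx.
have b0 := harnack_const_gt0 c01.
have /choice[g hg] : forall k, exists n, (k < n)%N /\ link M0 x (iter n T x).
  by move=> k; have [n kn hn] := hrec k.+1; exists n.
have [eta Keta cl] : exists2 q, K q & forall (e : R) N, 0 < e ->
    exists2 k, (N <= k)%N & rnorm (iter (g k) T x - q) < e.
  apply: (compact_cluster cK) => k; apply: iter_compact => //.
  by case: (hg k) => h _; apply: leq_ltn_trans h.
have rho0 : 0 < harnack_const c ^+ M0 * r0 by rewrite mulr_gt0 // exprn_gt0.
have Deta : D eta.
  have [k _ hk] := cl _ 0%N rho0; have [_ lk] := hg k.
  by apply: (link_ball scD c01 r00 bx lk); rewrite rnormB.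
have [r r1 hr] := link_near_point oD c01 Deta.
have ret N : exists2 n, (N < n)%N & link 1 eta (iter n T x).
  have [k Nk hk] := cl r N r1; exists (g k); last by case: (hr _ hk).
  by case: (hg k) => h _; apply: leq_ltn_trans h.
(* Two steps, so that a point one step from [iter m T x], itself one step from [eta], is again a
   return. *)
pose I n := (0 < n)%N /\ link 2 eta (iter n T x).
have [L hL] : exists L, forall n, I n -> exists2 m, I m /\ (m <= L)%N & link 1 (iter m T x) (iter n T x).
  (* Otherwise infinitely many returns are pairwise not one step apart, although they lie in a
     compact set and carry balls of a common radius [rh]. *)
  apply: contrapT => /forallNP H.
  have /choice[h hh] : forall L, exists n, I n /\
      forall m, I m -> (m <= L)%N -> ~ link 1 (iter m T x) (iter n T x).
    move=> L; apply: contrapT => H'; apply: (H L) => n In; apply: contrapT => H2; apply: H'.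
    by exists n; split=> // m Im mL lk; apply: H2; exists m.
  pose a := fix a k := if k is k'.+1 then h (a k') else h 0%N.
  have aI k : I (a k) by case: k => [|k]; exact: (hh _).1.
  have alt k : (a k < a k.+1)%N.
    rewrite ltnNge; apply/negP => le; apply: ((hh (a k)).2 _ (aI k.+1) le).
    by apply: link_refl => //; exact: iter_in.
  have amono j k : (j < k)%N -> (a j < a k)%N.
    move=> jk; apply: (homo_ltn (@ltn_trans) alt) jk.
  have afar j k : (j < k)%N -> ~ link 1 (iter (a j) T x) (iter (a k) T x).
    case: k => // k; rewrite ltnS => jk; apply: (hh (a k)).2; first exact: aI.
    by move: jk; rewrite leq_eqVlt => /orP[/eqP ->//|/amono/ltnW].
  have [re re0 be] := open_inball oD Deta.
  pose rh := harnack_const c ^+ 2 * re.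
  have rh0 : 0 < rh by rewrite mulr_gt0 // exprn_gt0.
  have ba k : inball D (iter (a k) T x) rh by apply: (link_ball scD c01 re0 be); exact: (aI k).2.
  have [q Kq clq] : exists2 q, K q & forall (e : R) N, 0 < e ->
      exists2 k, (N <= k)%N & rnorm (iter (a k) T x - q) < e.
    by apply: (compact_cluster cK) => k; apply: iter_compact => //; exact: (aI k).1.
  have e0 : 0 < rh * c / 2 by rewrite divr_gt0 // mulr_gt0.
  have [j _ hj] := clq _ 0%N e0; have [k jk hk] := clq _ j.+1 e0.
  apply: (afar j k jk); apply: link1; first exact: iter_in.
  apply: near_small rh0 (ba j) (ba k) _ => //.
  by apply: le_lt_trans (rnorm_tri _ q _) _; rewrite (rnormB q); lra.
have [m Lm hm] := ret L.
have Im : I m by split; [exact: leq_ltn_trans Lm | exact: (link_mono c01 Deta _ hm)].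
(* Applying [T] [m - m'] more times moves the early return [m'] to [m], and [n] to the next
   return. *)
have step n : I n -> exists n', [/\ I n', (n < n')%N & (n' <= n + m)%N].
  move=> In; have [m' [Im' m'L] lk] := hL n In.
  have m'm : (m' < m)%N := leq_ltn_trans m'L Lm.
  exists (m - m' + n)%N; split.
    split; first by rewrite addn_gt0 subn_gt0 m'm.
    rewrite iterD; apply: link_cat hm _.
    have := link_iter (m - m') (iter_in m' Dx) lk.
    by rewrite -iterD subnK // ltnW.
    by rewrite -[X in (X < _)%N]add0n ltn_add2r subn_gt0.
  by rewrite addnC leq_add2l leq_subr.
have window n : (m <= n)%N -> exists j, [/\ I j, (j <= n)%N & (n < j + m)%N].
  have m0 : (0 < m)%N by case: Im.
  move=> /subnKC <-; elim: (n - m)%N => [|i [j [Ij jn nj]]].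
    by exists m; rewrite addn0 -[X in (X < _)%N]addn0 ltn_add2l m0.
  have [lt|ge] := ltnP (m + i.+1) (j + m).
    by exists j; split=> //; rewrite addnS ltnW.
  have E : (m + i.+1 = j + m)%N.
    by apply/eqP; rewrite eqn_leq ge andbT addnS.
  have [j' [Ij' jj' j'm]] := step j Ij; exists j'; rewrite E; split=> //.
  by rewrite ltn_add2r.
have /choice[e he] : forall l, exists b, link b x (iter l T x).
  by move=> l; apply: link_exists => //; exact: iter_in.
have [e' he'] := link_exists oD scD c01 Dx Deta.
pose Bm := \max_(l < m) e l.
have hBm l : (l < m)%N -> link Bm x (iter l T x).
  move=> lm; apply: (link_mono c01 Dx _ (he l)).
  exact: (@leq_bigmax _ (fun l : 'I_m => e l) (Ordinal lm)).
(* The pieces lead from [x] to [eta], then to a return at time [j] with [n - j < m], then along a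
   translate of an initial piece of the orbit. *)
exists (e' + (2 + Bm))%N => n; have [nm|mn] := ltnP n m.
  by apply: (link_mono c01 Dx _ (hBm n nm)); rewrite addnA leq_addl.
have [j [[_ Ij] jn nj]] := window n mn.
apply: link_cat he' _; apply: link_cat Ij _.
rewrite -(subnK jn) addnC iterD.
have lt : (n - j < m)%N by rewrite ltn_subLR.
exact: link_iter (hBm _ lt).
Qed.

End Orbits.

(** * Convergence of orbits to a boundary point *)

Section DenjoyWolff.
Variables (R : realType) (V : completeNormedModType R[i]) (D K : set V) (M c : R) (T : V -> V).
Hypotheses (oD : open D) (scD : strictly_convex D) (bD : forall v, D v -> rnorm v <= M).
Hypotheses (TD : set_fun D D T) (nT : nonexpansive D T).
Hypotheses (cK : compact K) (TK : forall x, D x -> K (T x)) (c01 : 0 < c < 1).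
Implicit Types (x y u v q : V) (n m k : nat).

Local Notation link := (link D c).

(** Membership in [D] stands inside the existential so that a value can be chosen for all pairs;
    outside [D] it is arbitrary. *)
Lemma ldist_exists x y : exists d : nat, D x -> D y -> forall n, (d <= n)%N <-> link n x y.
Proof.
have [[Dx Dy]|nD] := pselect (D x /\ D y); last first.
  by exists 0%N => Dx Dy; case: nD.
have ex : exists n, `[< link n x y >].
  by have [n hn] := link_exists oD scD c01 Dx Dy; exists n; apply/asboolP.
case: (ex_minnP ex) => d /asboolP hd mind; exists d => _ _ n; split.
  by move=> dn; exact: link_mono hd.
by move=> h; apply: mind; apply/asboolP.
Qed.

Definition ldist x y : nat := projT1 (cid (ldist_exists x y)).

Lemma ldistP n x y : D x -> D y -> (ldist x y <= n)%N <-> link n x y.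
Proof. by move=> Dx Dy; exact: (projT2 (cid (ldist_exists x y)) Dx Dy n). Qed.

Lemma ldist_tri x y v : D x -> D y -> D v -> (ldist x v <= ldist x y + ldist y v)%N.
Proof.
move=> Dx Dy Dv; apply/ldistP => //.
have xy : link (ldist x y) x y by apply/ldistP.
by apply: link_cat xy _; apply/ldistP.
Qed.

(* Karlsson's argument. Along times [r_i] at which [d (x, T^r x)] attains its
   running maximum, the orbit clusters at some [xi]. Let [eta] be another cluster
   point, [T^k x] close to [eta], and [v] on a chain from [x] to [T^(r_i - k) x] with
   [d (x, v) <= A]. Then [T^k v] is close to [eta], it is nearer than [x] to [T^(r_i) x]
   by [A], and so is the midpoint of the last two points, which is close to the
   midpoint [m] of [xi] and [eta]. Hence [A <= d (x, m) + 1] for every [A]. *)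
Lemma orbit_cvg_boundary x : D x -> (forall q, D q -> T q <> q) ->
  exists xi, [/\ closure D xi, ~ D xi & forall e : R, 0 < e ->
    exists N, forall n, (N <= n)%N -> rnorm (iter n T x - xi) < e].
Proof.
move=> Dx nofix.
have inD n : D (iter n T x) by exact: iter_in.
pose a n := ldist x (iter n T x).
have ainf B : exists N, forall n, (N <= n)%N -> (B < a n)%N.
  apply: contrapT => /forallNP H.
  have [N|B' hB'] := recurrent_orbit_bounded oD scD TD nT cK TK c01 Dx (M0 := B).
    have /existsNP[n /not_implyP[Nn /negP hn]] := H N; exists n => //.
    by apply/ldistP => //; rewrite leqNgt.
  have [q Dq Tq] := bounded_orbit_fixpoint oD scD bD TD nT cK TK c01 Dx hB'.
  exact: (nofix q Dq Tq).
(* A record is the first time at which [a] exceeds its maximum over the times up to [L]. *)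
have rec L : exists n, (L <= n)%N /\ forall m, (m <= n)%N -> (a m <= a n)%N.
  pose B := \max_(m < L.+1) a m.
  have [N hN] := ainf B.
  have ex : exists n, (B < a n)%N by exists N; exact: hN.
  case: (ex_minnP ex) => n Bn minn; exists n; split.
    rewrite leqNgt; apply/negP => nL.
    have := @leq_bigmax _ (fun m : 'I_L.+1 => a m) (Ordinal (ltn_trans nL (ltnSn L))).
    by rewrite -/B /= leqNgt Bn.
  move=> m; rewrite leq_eqVlt => /orP[/eqP -> //|mn].
  apply: leq_trans (ltnW Bn); rewrite leqNgt; apply/negP => /minn.
  by rewrite leqNgt mn.
have /choice[r hr] := rec.
have clD (u : nat -> nat) q : (forall (e : R) N, 0 < e ->
    exists2 k, (N <= k)%N & rnorm (iter (u k) T x - q) < e) -> closure D q.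
  by move=> h; apply/closure_rnormP => e e0; have [k _ hk] := h e 0%N e0; exists (iter (u k) T x).
have nD (u : nat -> nat) q : (forall k, (k <= u k)%N) -> (forall (e : R) N, 0 < e ->
    exists2 k, (N <= k)%N & rnorm (iter (u k) T x - q) < e) -> ~ D q.
  move=> hu h Dq; have [d d0 hd] := link_near_point oD c01 Dq.
  have [N hN] := ainf (ldist x q + 1)%N; have [k Nk hk] := h d N d0.
  have [Du qu _] := hd _ hk.
  have := hN (u k) (leq_trans Nk (hu k)); rewrite ltnNge => /negP; apply.
  by apply: leq_trans (ldist_tri Dx Dq Du) _; rewrite leq_add2l; apply/ldistP.
have [xi Kxi clxi] : exists2 q, K q & forall (e : R) N, 0 < e ->
    exists2 k, (N <= k)%N & rnorm (iter (r k.+1) T x - q) < e.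
  apply: (compact_cluster cK) => k; apply: (iter_compact TD TK) => //.
  exact: leq_trans (hr k.+1).1.
have cxi := clD (fun k => r k.+1) xi clxi.
have nxi : ~ D xi by apply: (nD (fun k => r k.+1)) clxi => k; apply: leq_trans (hr _).1.
exists xi; split=> // e e0; apply: contrapT => /forallNP H.
have /choice[s hs] : forall N, exists n, (N < n)%N /\ e <= rnorm (iter n T x - xi).
  move=> N; have /existsNP[n /not_implyP[Nn /negP hn]] := H N.+1.
  by exists n; split=> //; rewrite leNgt.
have [eta Keta cleta] : exists2 q, K q & forall (e : R) N, 0 < e ->
    exists2 k, (N <= k)%N & rnorm (iter (s k) T x - q) < e.
  apply: (compact_cluster cK) => k; apply: (iter_compact TD TK) => //.
  by apply: leq_ltn_trans (hs k).1.
have ceta := clD s eta cleta.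
have neta : ~ D eta by apply: (nD s) cleta => k; exact: ltnW (hs k).1.
have xieta : xi <> eta.
  by move=> E; have [k _] := cleta e 0%N e0; rewrite -E ltNge (hs k).2.
have h01 : 0 < (2^-1 : R) < 1 by rewrite invr_gt0 ltr0n invf_lt1 // ltr1n.
have h01' : 0 <= (2^-1 : R) <= 1 by case/andP: h01 => *; rewrite !ltW.
set m : V := 2^-1%:C *: eta + (1 - 2^-1)%:C *: xi.
have Dm : D m by apply: scD => //; exact/nesym.
have [d d0 hd] := link_near_point oD c01 Dm.
(* One more than the final count allows. *)
pose A := (ldist x m + 2)%N.
have [d1 d10 hd1] := boundary_stable oD scD c01 A cK ceta neta d0.
have [k _ hk] := cleta d1 0%N d10.
set n := s k in hk.
have n0 : (0 < n)%N by apply: leq_ltn_trans (hs k).1.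
have [N hN] := ainf A.
have [i Ni hi] := clxi d (n + N)%N d0.
set ri := r i.+1 in hi.
have nri : (n + N <= ri)%N by apply: leq_trans (hr i.+1).1; exact: leqW.
have nri' : (n <= ri)%N by apply: leq_trans nri; exact: leq_addr.
pose y := iter (ri - n) T x.
have Ay : (A < a (ri - n))%N by apply: hN; rewrite leq_subRL.
have [v xv vy] : exists2 v, link A x v & link (a (ri - n)%N - A)%N v y.
  by apply: link_split; rewrite (subnKC (ltnW Ay)); apply/(ldistP _ Dx (inD _)).
have Dv : D v := link_in Dx xv.
pose u := iter n T v.
have Du : D u by exact: iter_in.
have Ku : K u by exact: (iter_compact TD TK).
have ueta : rnorm (u - eta) < d by apply: (hd1 _ _ (inD n) Du Ku hk); exact: (link_iter TD nT c01).
(* As [ri] is a record time, [a (ri - n) - A] is at most [a ri - A]. *)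
have uri : link (a ri - A)%N u (iter ri T x).
  have -> : iter ri T x = iter n T y by rewrite -iterD subnKC.
  apply: (link_mono c01 Du (n := (a (ri - n) - A)%N)); last exact: (link_iter TD nT c01).
  by apply: leq_sub2r; apply: (hr i.+1).2; exact: leq_subr.
pose p : V := 2^-1%:C *: u + (1 - 2^-1)%:C *: iter ri T x.
have pri : link (a ri - A)%N p (iter ri T x).
  by have := link_cvx scD h01' uri (link_refl c01 _ (inD ri)); rewrite comb_self.
have pm : rnorm (p - m) < d.
  have -> : p - m = (2^-1)%:C *: (u - eta) + (1 - 2^-1)%:C *: (iter ri T x - xi).
    by rewrite /p /m opprD addrACA !scalerBr.
  have h2 : 1 - 2^-1 = 2^-1 :> R by field.
  rewrite h2; apply: le_lt_trans (rnormD _ _) _.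
  by rewrite !(@rnormZ _ V ((2^-1)%:C : R[i]^o)) rnormC_ge0 ?invr_ge0 ?ler0n //; lra.
have [Dp mp _] := hd p pm.
have xm : link (ldist x m) x m by apply/ldistP.
have : (a ri <= ldist x m + (1 + (a ri - A)))%N.
  by apply/ldistP => //; apply: link_cat xm _; exact: link_cat mp pri.
(* This makes the truncated subtraction [a ri - A] exact. *)
have : (A <= a ri)%N.
  by apply: leq_trans (ltnW Ay) _; apply: (hr i.+1).2; exact: leq_subr.
move=> /subnKC {1}<-; by rewrite /A addnA leq_add2r leq_add2l.
Qed.
End DenjoyWolff.

(** * Semigroups *)

Lemma bounded_set_rnorm (R : realType) (V : normedModType R[i]) (D : set V) :
  bounded_set D -> exists M : R, forall v, D v -> rnorm v <= M.
Proof.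
move=> [m [mR hm]]; exists (complex.Re m + 1) => v Dv.
have lt : m < (complex.Re m + 1)%:C by rewrite -[m in m < _]RRe_real // ltcR ltrDl.
by have := hm _ lt v Dv; rewrite /= normE lecR.
Qed.

Section Semigroup.
Variables (R : realType) (V : normedModType R[i]) (D : set V) (f : R -> V -> V).
Hypotheses (oD : open D) (scD : strictly_convex D) (fS : continuous_semigroup D f).
Hypothesis nf : forall t : R, 0 <= t -> nonexpansive D (f t).

Lemma semigroup_iter (t : R) n x : 0 <= t -> D x -> iter n (f t) x = f (n%:R * t) x.
Proof.
have [fD fA f0 _] := fS; move=> t0 Dx; elim: n => [|n IH]; first by rewrite mul0r f0.
by rewrite iterS IH -fA ?mulr_ge0 // -natr1 mulrDl mul1r.
Qed.

(** Continuity at time 0 gives a time [d] before which [x] moves by one step; nonexpansiveness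
    propagates this in increments of [d / 2]. *)
Lemma semigroup_orbit_bounded (c t0 : R) x : 0 < c < 1 -> 0 < t0 -> D x ->
  exists B, forall r : R, 0 <= r <= t0 -> link D c B x (f r x).
Proof.
move=> c01 t00 Dx; have [fD fA f0 fc] := fS.
have [rho rho0 hrho] := link_near_point oD c01 Dx.
have [d d0 hd] : exists2 d : R, 0 < d & forall r : R, 0 <= r < d -> link D c 1 x (f r x).
  have : nbhs x [set y | rnorm (y - x) < rho] by apply/nbhs_rnormP; exists rho.
  move=> /(fc x Dx)[d /= d0 hd]; exists d => // r /andP[r0 rd].
  have [->|rN0] := eqVneq r 0; first by rewrite f0 //; exact: (link_refl c01 1 Dx).
  have rp : 0 < r by rewrite lt_neqAle eq_sym rN0.
  have := hd r; rewrite /= sub0r normrN ger0_norm // => /(_ rd rp) hr.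
  by case: (hrho _ hr).
pose d' := d / 2; have d'0 : 0 < d' by rewrite divr_gt0.
have step (r : R) j : 0 <= r < d -> link D c j.+1 x (f (r + j%:R * d') x).
  move=> hr; elim: j => [|j IH] in r hr *; first by rewrite mul0r addr0; exact: hd.
  have r0 : 0 <= r by case/andP: hr.
  have hd' : 0 <= d' < d by rewrite ltW //= /d'; lra.
  have -> : r + j.+1%:R * d' = r + (d' + j%:R * d') by rewrite -natr1 mulrDl mul1r; ring.
  have jd0 : 0 <= d' + j%:R * d' by rewrite addr_ge0 ?mulr_ge0 // ltW.
  rewrite fA //; have := link_cat (IH _ hd') (link_map c01 (fD _ jd0) (nf jd0) Dx (hd r hr)).
  by rewrite addn1.
exists (Num.truncn (t0 / d')).+1 => r /andP[r0 rt].
have rd0 : 0 <= r / d' by rewrite divr_ge0 // ltW.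
have /andP[j1 j2] := truncn_itv rd0; set j := Num.truncn (r / d') in j1 j2.
apply: (link_mono c01 Dx (n := j.+1)).
  by rewrite ltnS; apply: le_truncn; rewrite ler_pM2r ?invr_gt0.
have := @step (r - j%:R * d') j; rewrite subrK; apply.
rewrite subr_ge0 -ler_pdivlMr // j1 /= ltrBlDl.
move: j2; rewrite ltr_pdivrMr // -natr1 mulrDl mul1r => /lt_le_trans; apply.
by rewrite lerD2l /d'; lra.
Qed.
End Semigroup.

Theorem corollary3p11 (R : realType) (V : completeNormedModType R[i])
    (D : set V) (f : R -> V -> V) :
  domain D -> bounded_set D -> strictly_convex D ->
  continuous_semigroup D f ->
  (forall t : R, 0 <= t -> nonexpansive D (f t)) ->
  (exists t0 : R, [/\ 0 < t0, Fix D (f t0) = set0 & compact_map D (f t0)]) ->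
  exists xi : V, boundary D xi /\
    forall C : set V, C `<=` D -> kobayashi_bounded D C ->
      cvg_uniformly_on C f xi.
Proof.
move=> [[x0 Dx0] oD _] /bounded_set_rnorm[M bD] scD fS nf [t0 [t00 nofix cK]].
have [fD fA f0 _] := fS.
set T := f t0 in nofix cK; set K := closure (T @` D) in cK.
have TD : set_fun D D T by exact: fD (ltW t00).
have nT : nonexpansive D T by exact: nf (ltW t00).
have TK x : D x -> K (T x) by move=> Dx; apply: subset_closure; exists x.
have nofixT q : D q -> T q <> q.
  by move=> Dq Tq; have : Fix D T q by []; rewrite nofix.
have h01 : 0 < (2^-1 : R) < 1 by rewrite invr_gt0 ltr0n invf_lt1 // ltr1n.
have [xi [cxi nxi xilim]] := orbit_cvg_boundary oD scD bD TD nT cK TK h01 Dx0 nofixT.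
exists xi; split=> // C CD [m Cm].
(* For empty [C] the supremum takes its default value 0. *)
have [[y0 Cy0]|C0] := pselect (C !=set0); last first.
  have -> : C = set0 by apply/seteqP; split=> // y Cy; case: C0; exists y.
  rewrite /cvg_uniformly_on; under eq_fun do rewrite image_set0 sup0.
  exact: cvg_cst.
(* The step size is adapted to [C], so that any two of its points are one step apart. *)
have [c c01 mc] := artanh_unbounded m.
have Cnear x y : C x -> C y -> near D c x y.
  by move=> Cx Cy; apply/nearP => //; split; apply: le_lt_trans (Cm _ _ _ _) _; rewrite ?lte_fin.
have [n0 hn0] := link_exists oD scD c01 Dx0 (CD _ Cy0).
have [B hB] := semigroup_orbit_bounded oD fS nf c01 t00 Dx0.
(* For a remainder [r] in [[0, t0]]: [B] steps from [x0] to [f r x0], [n0] on to [f r y0], one to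
   [f r x]. Iterating [T] preserves the chain. *)
pose W := (B + (n0 + 1))%N.
have orb (t : R) x : 0 <= t -> C x -> let n := Num.truncn (t / t0) in
    exists2 y, D y /\ f t x = iter n T y & link D c W (iter n T x0) (iter n T y).
  move=> tge Cx n; have Dx := CD _ Cx.
  have tt0 : 0 <= t / t0 by rewrite divr_ge0 // ltW.
  have /andP[n1 n2] := truncn_itv tt0.
  pose r := t - n%:R * t0.
  have r0 : 0 <= r by rewrite subr_ge0 -ler_pdivlMr.
  have rt : r <= t0.
    by rewrite lerBlDl; move: n2; rewrite ltr_pdivrMr // -natr1 mulrDl mul1r => /ltW.
  have nt0 : 0 <= n%:R * t0 by rewrite mulr_ge0 // ltW.
  have Dr : D (f r x) by exact: fD.
  exists (f r x).
    by split=> //; rewrite (semigroup_iter fS) ?(ltW t00) // -fA // subrK.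
  apply: link_iter => //; apply: link_cat (hB r _) _; first by rewrite r0.
  apply: link_map => //; [exact: fD | exact: nf | ].
  by apply: link_cat hn0 _; apply: link1 => //; exact: Cnear.
have unif (e : R) : 0 < e -> exists t1 : R, forall t x, t1 < t -> C x -> rnorm (f t x - xi) < e.
  move=> e0; have [d d0 hd] := boundary_stable oD scD c01 W cK cxi nxi e0.
  (* Beyond time [N.+1 * t0] the number of full iterates of [T] exceeds [N]; being positive, it also
     puts [f t x] into [K]. *)
  have [N hN] := xilim d d0; exists (N.+1%:R * t0) => t x tN Cx.
  have tge : 0 <= t by apply: le_trans (ltW tN); rewrite mulr_ge0 // ltW.
  have [y [Dy ->] lk] := orb t x tge Cx.
  have Nn : (N < Num.truncn (t / t0))%N.
    by rewrite truncn_ge_nat ?divr_ge0 ?(ltW t00) // ler_pdivlMr // ltW.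
  apply: hd lk; [exact: iter_in | exact: iter_in | | exact: hN (ltnW Nn)].
  by apply: (iter_compact TD TK) => //; exact: leq_ltn_trans Nn.
(* Halving [e] keeps the inequality strict after passing to the supremum. *)
apply/cvgrPdist_lt => e e0; have [t1 ht1] := unif _ (divr_gt0 e0 (ltr0Sn _ 1)).
exists t1; split; first exact: num_real.
move=> t t1t; rewrite sub0r normrN.
have ub : ubound [set rnorm (f t x - xi) | x in C] (e / 2).
  by move=> _ [x Cx <-]; apply/ltW/ht1.
have ne : [set rnorm (f t x - xi) | x in C] !=set0 by exists (rnorm (f t y0 - xi)), y0.
have s0 : 0 <= sup [set rnorm (f t x - xi) | x in C].
  apply: le_trans (rnorm_ge0 (f t y0 - xi)) _; apply: sup_ubound; last by exists y0.
  by exists (e / 2).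
rewrite ger0_norm //; apply: le_lt_trans (sup_le_ub ne ub) _; lra.
Qed.
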